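(* Let $b>0$ and let $f\in C^2[-b,b]$ be complex-valued with $f(x)\ne0$ on $[-b,b]$ and $f(0)=1$. Let $\overline{\mathbf{R}}=[-b,b]\times[-b,b]$, and let $W=u+\mathbf{j}v$ ($u,v$ complex-valued) be a solution in $\overline{\mathbf{R}}$ of the hyperbolic Vekua equation $$\partial_{\bar z}W-\frac{f'(x)}{2f(x)}\overline W=0 .$$ Then $W$ can be represented as a series $$W(z)=\sum_{n=0}^\infty Z^{(n)}(a_n,0;z),\qquad a_n\in\mathbb{B},$$ uniformly convergent in $\overline{\mathbf{R}}$, if and only if the functions $u(x,x)$ and $u(x,-x)$ admit series expansions of the form $$\tfrac12\bigl(u(x,x)+u(x,-x)\bigr)=c_0u_0(x,x)+\sum_{n=1}^\infty c_nu_{2n-1}(x,x),\qquad \tfrac12\bigl(u(x,x)-u(x,-x)\bigr)=\sum_{n=1}^\infty b_nu_{2n}(x,x),$$ uniformly convergent on $[-b,b]$, with $c_n,b_n\in\mathbb{C}$; here the coefficients of the expansions are related by $a_n=c_n+\mathbf{j}b_n$, $n=0,1,\ldots$, where the coefficient $b_0$ is the value of $v$ at the origin, $b_0=v(0,0)$.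
   Context: $\mathbb{B}=\{w=u+v\mathbf{j}:u,v\in\mathbb{C}\}$ is the commutative algebra of bicomplex numbers, $\mathbf{j}^2=1$, the complex unit $\mathbf{i}$ commuting with $\mathbf{j}$; $\overline w=u-v\mathbf{j}$. The norm is $|w|=\frac12(|u+v|+|u-v|)$. The variable is $z=x+t\mathbf{j}$ with $x,t\in\mathbb{R}$ and $\partial_{\bar z}=\frac12(\partial_x-\mathbf{j}\partial_t)$. Solutions are continuously differentiable $\mathbb{B}$-valued functions of $(x,t)$. Set $X^{(0)}\equiv\widetilde X^{(0)}\equiv1$ and, for $n\ge1$, $$X^{(n)}(x)=n\int_0^xX^{(n-1)}(s)\bigl(f^2(s)\bigr)^{(-1)^n}ds,\qquad \widetilde X^{(n)}(x)=n\int_0^x\widetilde X^{(n-1)}(s)\bigl(f^2(s)\bigr)^{(-1)^{n-1}}ds.$$ Let $\varphi_k=fX^{(k)}$, $\psi_k=\widetilde X^{(k)}/f$ for odd $k$ and $\varphi_k=f\widetilde X^{(k)}$, $\psi_k=X^{(k)}/f$ for even $k$. The generalized wave polynomials are $u_0=\varphi_0(x)$, $v_0=\psi_0(x)$ and, for $m\ge1$, $$u_{2m-1}(x,t)=\sum_{\text{even }k=0}^m\binom mk\varphi_{m-k}(x)t^k,\qquad u_{2m}(x,t)=\sum_{\text{odd }k=1}^m\binom mk\varphi_{m-k}(x)t^k,$$ $$v_{2m-1}(x,t)=\sum_{\text{even }k=0}^m\binom mk\psi_{m-k}(x)t^k,\qquad v_{2m}(x,t)=\sum_{\text{odd }k=1}^m\binom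 mk\psi_{m-k}(x)t^k.$$ The formal powers with center $0$ and coefficient $a=a'+\mathbf{j}a''$ ($a',a''\in\mathbb{C}$) are $Z^{(0)}(a,0;z)=a'u_0(x,t)+\mathbf{j}a''v_0(x,t)$ and, for $n\ge1$, $$Z^{(n)}(a,0;z)=a'u_{2n-1}(x,t)+a''u_{2n}(x,t)+\mathbf{j}\bigl(a'v_{2n}(x,t)+a''v_{2n-1}(x,t)\bigr).$$ *)

(* Defs.v *)
From Stdlib Require Import Reals.
From Coquelicot Require Import Coquelicot.

Open Scope C_scope.

(* [(u, v)] stands for u + v j, with j^2 = 1. *)
Definition bicomplex : Type := (C * C)%type.

(* The product topology is that of the bicomplex norm [Bnorm] below, so limits
   and derivatives may be taken in this real normed module. *)
Definition B_NormedModule : NormedModule R_AbsRing :=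
  prod_NormedModule R_AbsRing C_R_NormedModule C_R_NormedModule.

Definition Bminus (z w : bicomplex) : bicomplex :=
  (fst z - fst w, snd z - snd w).
Definition Bmult (z w : bicomplex) : bicomplex :=
  (fst z * fst w + snd z * snd w, fst z * snd w + snd z * fst w).
Definition Bconj (w : bicomplex) : bicomplex := (fst w, - snd w).
Definition Bnorm (w : bicomplex) : R :=
  ((Cmod (fst w + snd w) + Cmod (fst w - snd w)) / 2)%R.
Definition CtoB (c : C) : bicomplex := (c, RtoC 0).
Definition Bj : bicomplex := (RtoC 0, RtoC 1).

Definition segment (b : R) (x : R) : Prop := (- b <= x <= b)%R.
Definition square (b : R) (p : R * R) : Prop :=
  segment b (fst p) /\ segment b (snd p).

(* [is_derive] with the filter restricted to [D]: a one-sided derivative at the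
   endpoints when [D] is a segment. *)
Definition is_derive_within {V : NormedModule R_AbsRing}
    (D : R -> Prop) (g : R -> V) (x : R) (l : V) : Prop :=
  filterdiff g (within D (locally x)) (fun h : R => scal h l).

(* [f1] and [f2] are the first and second derivatives of [f] on [-b, b]; their
   values outside the segment are irrelevant. *)
Definition C2_on_segment (b : R) (f f1 f2 : R -> C) : Prop :=
  (forall x, segment b x ->
     is_derive_within (V := C_R_NormedModule) (segment b) f x (f1 x)) /\
  (forall x, segment b x ->
     is_derive_within (V := C_R_NormedModule) (segment b) f1 x (f2 x)) /\
  continuous_on (T := R_UniformSpace) (U := C_R_NormedModule) (segment b) f2.

(* [Wx] and [Wt] are the partial derivatives of [W], one-sided on the sides of
   the square, and are continuous up to the boundary. *)
Definition C1_on_square (b : R) (W Wx Wt : R -> R -> bicomplex) : Prop :=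
  (forall x t, square b (x, t) ->
     is_derive_within (V := B_NormedModule) (segment b)
       (fun s => W s t) x (Wx x t) /\
     is_derive_within (V := B_NormedModule) (segment b)
       (fun s => W x s) t (Wt x t)) /\
  continuous_on (T := prod_UniformSpace R_UniformSpace R_UniformSpace)
    (U := B_NormedModule) (square b) (fun p => Wx (fst p) (snd p)) /\
  continuous_on (T := prod_UniformSpace R_UniformSpace R_UniformSpace)
    (U := B_NormedModule) (square b) (fun p => Wt (fst p) (snd p)).

(* (1/2) (d/dx - j d/dt), given the two partial derivatives. *)
Definition dbar (wx wt : bicomplex) : bicomplex :=
  Bmult (CtoB (/ 2)) (Bminus wx (Bmult Bj wt)).

Definition vekua_solution (b : R) (f f1 : R -> C)
    (W : R -> R -> bicomplex) : Prop :=
  exists Wx Wt : R -> R -> bicomplex,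
    C1_on_square b W Wx Wt /\
    forall x t, square b (x, t) ->
      Bminus (dbar (Wx x t) (Wt x t))
             (Bmult (CtoB (f1 x / (2 * f x))) (Bconj (W x t)))
      = CtoB 0.

(* w ^ ((-1) ^ n) *)
Definition alt_pow (w : C) (n : nat) : C := if Nat.even n then w else / w.

Fixpoint X_pow (f : R -> C) (n : nat) (x : R) : C :=
  match n with
  | O => RtoC 1
  | S p => RtoC (INR n) *
      RInt (V := C_R_CompleteNormedModule)
        (fun s => X_pow f p s * alt_pow (f s * f s) n) 0 x
  end.

Fixpoint Xtilde_pow (f : R -> C) (n : nat) (x : R) : C :=
  match n with
  | O => RtoC 1
  | S p => RtoC (INR n) *
      RInt (V := C_R_CompleteNormedModule)
        (fun s => Xtilde_pow f p s * alt_pow (f s * f s) (n - 1)) 0 x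
  end.

Definition phi (f : R -> C) (k : nat) (x : R) : C :=
  if Nat.odd k then f x * X_pow f k x else f x * Xtilde_pow f k x.
Definition psi (f : R -> C) (k : nat) (x : R) : C :=
  if Nat.odd k then Xtilde_pow f k x / f x else X_pow f k x / f x.

Definition even_sum (g : nat -> R -> C) (m : nat) (x t : R) : C :=
  sum_n_m (G := C_AbelianMonoid)
    (fun k => if Nat.even k
              then RtoC (Binomial.C m k) * g (m - k)%nat x * RtoC (t ^ k)
              else RtoC 0) 0 m.
Definition odd_sum (g : nat -> R -> C) (m : nat) (x t : R) : C :=
  sum_n_m (G := C_AbelianMonoid)
    (fun k => if Nat.odd k
              then RtoC (Binomial.C m k) * g (m - k)%nat x * RtoC (t ^ k)
              else RtoC 0) 1 m.

(* Index 2m-1 (m >= 1) carries the even sum of order m, index 2m the odd one. *)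
Definition wave_poly (g : nat -> R -> C) (n : nat) (x t : R) : C :=
  match n with
  | O => g 0%nat x
  | S p => if Nat.odd n then even_sum g (Nat.div2 (S n)) x t
           else odd_sum g (Nat.div2 n) x t
  end.

Definition wave_u (f : R -> C) : nat -> R -> R -> C := wave_poly (phi f).
Definition wave_v (f : R -> C) : nat -> R -> R -> C := wave_poly (psi f).

(* Formal power with center 0 and coefficient a = a' + j a''. *)
Definition formal_power (f : R -> C) (n : nat) (a : bicomplex) (x t : R) : bicomplex :=
  let (a', a'') := a in
  match n with
  | O => (a' * wave_u f 0 x t, a'' * wave_v f 0 x t)
  | S _ => (a' * wave_u f (2 * n - 1) x t + a'' * wave_u f (2 * n) x t,
            a' * wave_v f (2 * n) x t + a'' * wave_v f (2 * n - 1) x t)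
  end.

Definition B_unif_cvg {T : Type} (D : T -> Prop)
    (S : nat -> T -> bicomplex) (g : T -> bicomplex) : Prop :=
  forall eps : posreal, exists N : nat, forall n, (N <= n)%nat ->
    forall p, D p -> (Bnorm (Bminus (S n p) (g p)) < eps)%R.

Definition C_unif_cvg {T : Type} (D : T -> Prop)
    (S : nat -> T -> C) (g : T -> C) : Prop :=
  forall eps : posreal, exists N : nat, forall n, (N <= n)%nat ->
    forall p, D p -> (Cmod (S n p - g p) < eps)%R.

Definition formal_power_expansion (b : R) (f : R -> C)
    (W : R -> R -> bicomplex) (a : nat -> bicomplex) : Prop :=
  B_unif_cvg (square b)
    (fun N p => sum_n (G := B_NormedModule)
       (fun n => formal_power f n (a n) (fst p) (snd p)) N)
    (fun p => W (fst p) (snd p)).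

(* The entry [bb 0] does not occur. *)
Definition goursat_expansions (b : R) (f : R -> C)
    (u : R -> R -> C) (c bb : nat -> C) : Prop :=
  C_unif_cvg (segment b)
    (fun N x => c 0%nat * wave_u f 0 x x +
       sum_n_m (G := C_AbelianMonoid)
         (fun n => c n * wave_u f (2 * n - 1) x x) 1 N)
    (fun x => / 2 * (u x x + u x (- x)%R)) /\
  C_unif_cvg (segment b)
    (fun N x => sum_n_m (G := C_AbelianMonoid)
       (fun n => bb n * wave_u f (2 * n) x x) 1 N)
    (fun x => / 2 * (u x x - u x (- x)%R)).

(* Main.v *)
Require Import Defs.
From Stdlib Require Import Reals Lra Lia.
From Coquelicot Require Import Coquelicot.

(** Write [W = u + v j]. For [sigma = 1] and [sigma = -1] the combination
    [A sigma = u - sigma v] satisfies, along the characteristic direction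
    [(1, sigma)], the ordinary differential equation
    [d (A sigma) = g A (- sigma)] with [g = f' / f]; the two equations together
    are the Vekua equation. Everything rests on the continuous dependence of a
    solution on the traces of [u] on the two diagonals and on [v (0, 0)].

    A solution with [v (0, 0) = 0] and [|u| <= eps] on both diagonals satisfies
    [|W| <= kappa eps] on the closed square, with [kappa] depending on [b] and
    [f] only ([goursat_stability]). Indeed, on the diagonal of direction
    [(1, tau)] one has [A (- tau) = 2 u - A tau], so that
    [(f A tau)' = 2 f' u]: the trace of [u] and the value at the origin control
    both invariants there ([diagonal_estimate]). Every point of the square is
    joined to a diagonal by a characteristic segment that stays inside the
    square, and integrating the system along these segments is a contraction for
    a sup norm with an exponential weight ([goursat_estimate]). Only interior
    points enter this argument; separate continuity carries the bound to the
    sides.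

    The formal powers solve the same system, because
    [phi_k' = g phi_k + k psi_(k-1)] and [psi_k' = - g psi_k + k phi_(k-1)] make
    the characteristic derivative of a binomial sum telescope
    ([formal_power_characteristic_solution]). Since [u_(2n-1)] is even and
    [u_(2n)] odd in [t], the traces on the diagonals of a partial sum of formal
    powers are the sum and the difference of the partial sums of the two
    expansions on the diagonal. Restricting a formal power
    expansion to the diagonals therefore gives one implication
    ([goursat_of_formal_power_expansion]); conversely the difference between [W]
    and a partial sum is a solution with small traces, hence it is uniformly
    small ([formal_power_expansion_of_goursat]).

    For the coefficients, all [phi_k] and [psi_k] with [k >= 1] vanish at [0], so
    on the segment [x = 0] the formal power of degree [n] is a multiple of
    [t ^ n]. There a formal power expansion is an ordinary power series, which
    has at most one sequence of coefficients
    ([formal_power_expansion_unique]). *)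

Local Open Scope C_scope.

(** * Complex-valued functions of a real variable *)

Notation is_Cderive := (is_derive (K := R_AbsRing) (V := C_R_NormedModule)).

Notation Ccontinuous := (continuous (T := R_UniformSpace) (U := C_R_NormedModule)).

(** Sums in the abelian monoid [C] produce equations whose type is a projection of
    that structure, which [ring] and [field] do not recognize as [C]. *)
Ltac as_C := match goal with |- ?p = ?q => change (@eq C p q) end.

Lemma norm_C_R (z : C_R_NormedModule) : norm z = Cmod z.
Proof.
  unfold norm; simpl; unfold prod_norm, Cmod, norm; simpl; unfold abs; simpl.
  apply f_equal, f_equal2; exact (pow2_abs _).
Qed.

Lemma is_Cderive_components (h : R -> C) (x : R) (l : C) :
  is_Cderive h x l <->
  is_derive (fun s => fst (h s)) x (fst l) /\ is_derive (fun s => snd (h s)) x (snd l).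
Proof.
  split.
  - intros H; split.
    + apply (filterdiff_comp' (U := R_NormedModule) (V := C_R_NormedModule) (W := R_NormedModule)
        h (fun z => fst z) x _ (fun z => fst z) H).
      apply filterdiff_linear, (is_linear_fst (U := R_NormedModule) (V := R_NormedModule)).
    + apply (filterdiff_comp' (U := R_NormedModule) (V := C_R_NormedModule) (W := R_NormedModule)
        h (fun z => snd z) x _ (fun z => snd z) H).
      apply filterdiff_linear, (is_linear_snd (U := R_NormedModule) (V := R_NormedModule)).
  - intros [H1 H2].
    apply is_derive_ext with
      (fun s => plus (G := C_R_NormedModule) (scal (V := C_R_NormedModule) (fst (h s)) (RtoC 1))
                (scal (V := C_R_NormedModule) (snd (h s)) Ci)).
    { intros s. destruct (h s) as [p q]. unfold plus, scal; simpl.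
      unfold prod_plus, prod_scal, plus, scal; simpl; unfold mult; simpl. f_equal; ring. }
    replace l with (plus (G := C_R_NormedModule) (scal (V := C_R_NormedModule) (fst l) (RtoC 1))
                (scal (V := C_R_NormedModule) (snd l) Ci)).
    2:{ destruct l as [p q]. unfold plus, scal; simpl.
      unfold prod_plus, prod_scal, plus, scal; simpl; unfold mult; simpl. f_equal; ring. }
    apply (is_derive_plus (V := C_R_NormedModule));
    apply (is_derive_scal_l (V := C_R_NormedModule)); assumption.
Qed.

Lemma is_Cderive_plus (h k : R -> C) (x : R) (dh dk : C) :
  is_Cderive h x dh -> is_Cderive k x dk -> is_Cderive (fun s => h s + k s) x (dh + dk).
Proof. apply (is_derive_plus (V := C_R_NormedModule)). Qed.

Lemma is_Cderive_mult (h k : R -> C) (x : R) (dh dk : C) :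
  is_Cderive h x dh -> is_Cderive k x dk ->
  is_Cderive (fun s => h s * k s) x (dh * k x + h x * dk).
Proof.
  intros Hh Hk. apply is_Cderive_components in Hh. apply is_Cderive_components in Hk.
  destruct Hh as [Hh1 Hh2], Hk as [Hk1 Hk2].
  apply is_Cderive_components; split; simpl.
  - replace (_ + _)%R with ((fst dh * fst (k x) + fst (h x) * fst dk)
      - (snd dh * snd (k x) + snd (h x) * snd dk))%R by ring.
    apply (is_derive_minus (V := R_NormedModule) (fun s => fst (h s) * fst (k s))%R
       (fun s => snd (h s) * snd (k s))%R); apply (is_derive_mult (K := R_AbsRing)); auto; exact Rmult_comm.
  - replace (_ + _)%R with ((fst dh * snd (k x) + fst (h x) * snd dk)
      + (snd dh * fst (k x) + snd (h x) * fst dk))%R by ring.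
    apply (is_derive_plus (V := R_NormedModule) (fun s => fst (h s) * snd (k s))%R
       (fun s => snd (h s) * fst (k s))%R); apply (is_derive_mult (K := R_AbsRing)); auto; exact Rmult_comm.
Qed.

Lemma is_Cderive_const_mult (c : C) (h : R -> C) (x : R) (l : C) :
  is_Cderive h x l -> is_Cderive (fun s => c * h s) x (c * l).
Proof.
  intros H. evar_last.
  - apply (is_Cderive_mult (fun _ => c) h); [apply (is_derive_const (V := C_R_NormedModule))|exact H].
  - match goal with |- ?p = _ => change p with (0 * h x + c * l) end. ring.
Qed.

Lemma Cnonzero_sum_sqr (z : C) : z <> 0 -> (fst z * (fst z * 1) + snd z * (snd z * 1) <> 0)%R.
Proof.
  intros Hz H. apply Hz. destruct z as [p q]; simpl in *.
  apply injective_projections; simpl; nra.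
Qed.

Lemma is_Cderive_inv (h : R -> C) (x : R) (dh : C) :
  h x <> 0 -> is_Cderive h x dh -> is_Cderive (fun s => / h s) x (- dh / (h x * h x)).
Proof.
  intros Hx Hh. apply is_Cderive_components in Hh. destruct Hh as [H1 H2].
  assert (Hn := Cnonzero_sum_sqr _ Hx).
  assert (Hd : is_derive (fun s => fst (h s) * (fst (h s) * 1) + snd (h s) * (snd (h s) * 1))%R x
     (2 * fst dh * fst (h x) + 2 * snd dh * snd (h x))%R).
  { apply is_derive_ext with (fun s => fst (h s) * fst (h s) + snd (h s) * snd (h s))%R;
      [intros; simpl; ring|].
    replace (_ + _)%R with ((fst dh * fst (h x) + fst (h x) * fst dh)
      + (snd dh * snd (h x) + snd (h x) * snd dh))%R by ring.
    apply (is_derive_plus (V := R_NormedModule) (fun s => fst (h s) * fst (h s))%R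
       (fun s => snd (h s) * snd (h s))%R); apply (is_derive_mult (K := R_AbsRing)); auto;
      exact Rmult_comm. }
  assert (Hn' : forall p q : R, (p * (p * 1) + q * (q * 1) <> 0 ->
                 (p * p - q * q) * ((p * p - q * q) * 1)
                 + (p * q + q * p) * ((p * q + q * p) * 1) <> 0)%R).
  { intros p q H. replace (_ + _)%R with ((p * (p * 1) + q * (q * 1)) ^ 2)%R by ring.
    apply pow_nonzero, H. }
  specialize (Hn' _ _ Hn).
  apply is_Cderive_components; split; unfold Cinv; simpl.
  - evar_last; [apply (is_derive_div _ _ _ _ _ H1 Hd Hn)|].
    field; split; intros Q; [apply Hn'|apply Hn]; rewrite <- Q; ring.
  - evar_last; [apply (is_derive_div _ _ _ _ _ (is_derive_opp _ _ _ H2) Hd Hn)|].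
    unfold opp; simpl. field; split; intros Q; [apply Hn'|apply Hn]; rewrite <- Q; ring.
Qed.

Lemma is_Cderive_shift (h : R -> C) (x : R) (l : C) :
  is_Cderive h x l -> is_Cderive (fun s => h (x + s)%R) 0%R l.
Proof.
  intros H. evar_last.
  - apply (is_derive_comp (V := C_R_NormedModule) h (fun s => x + s)%R).
    + rewrite Rplus_0_r. exact H.
    + instantiate (1 := 1%R). auto_derive; auto.
  - apply (scal_one (V := C_R_NormedModule)).
Qed.

Lemma is_Cderive_RtoC (h : R -> R) (x l : R) :
  is_derive h x l -> is_Cderive (fun s => RtoC (h s)) x (RtoC l).
Proof.
  intros H. apply is_Cderive_components. split; simpl; auto.
  apply (is_derive_const (V := R_NormedModule)).
Qed.

Lemma filterlim_C_components {T : Type} (F : (T -> Prop) -> Prop) {FF : Filter F}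
    (h : T -> C) (l : C) :
  filterlim h F (locally (T := C_R_NormedModule) l) <->
  filterlim (fun s => fst (h s)) F (locally (fst l)) /\
  filterlim (fun s => snd (h s)) F (locally (snd l)).
Proof.
  split.
  - intros H; split; (eapply filterlim_comp; [exact H|]); destruct l as [p q].
    + apply (continuous_fst (U := R_UniformSpace) (V := R_UniformSpace)).
    + apply (continuous_snd (U := R_UniformSpace) (V := R_UniformSpace)).
  - intros [H1 H2]. apply (filterlim_locally (U := C_R_NormedModule)). intros eps.
    apply (filter_imp (fun s => ball (fst l) eps (fst (h s)) /\ ball (snd l) eps (snd (h s)))).
    + intros s [Hs1 Hs2]; split; assumption.
    + apply filter_and; [apply (proj1 (filterlim_locally _ _) H1)
                        |apply (proj1 (filterlim_locally _ _) H2)].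
Qed.

Lemma filterlim_Rplus {T : Type} (F : (T -> Prop) -> Prop) {FF : Filter F} (h k : T -> R) (l m : R) :
  filterlim h F (locally l) -> filterlim k F (locally m) ->
  filterlim (fun s => h s + k s)%R F (locally (l + m)%R).
Proof.
  intros Hh Hk.
  exact (filterlim_comp_2 h k Rplus Hh Hk (filterlim_plus (V := R_NormedModule) l m)).
Qed.

Lemma filterlim_Rmult {T : Type} (F : (T -> Prop) -> Prop) {FF : Filter F} (h k : T -> R) (l m : R) :
  filterlim h F (locally l) -> filterlim k F (locally m) ->
  filterlim (fun s => h s * k s)%R F (locally (l * m)%R).
Proof.
  intros Hh Hk.
  exact (filterlim_comp_2 h k Rmult Hh Hk (filterlim_mult (K := R_AbsRing) l m)).
Qed.

Lemma filterlim_Ropp {T : Type} (F : (T -> Prop) -> Prop) {FF : Filter F} (h : T -> R) (l : R) :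
  filterlim h F (locally l) ->
  filterlim (fun s => - h s)%R F (locally (- l)%R).
Proof.
  intros Hh.
  exact (filterlim_comp _ _ _ h Ropp F _ _ Hh (filterlim_opp (V := R_NormedModule) l)).
Qed.

Lemma filterlim_Cplus {T : Type} (F : (T -> Prop) -> Prop) {FF : Filter F} (h k : T -> C) (l m : C) :
  filterlim h F (locally (T := C_R_NormedModule) l) ->
  filterlim k F (locally (T := C_R_NormedModule) m) ->
  filterlim (fun s => h s + k s) F (locally (T := C_R_NormedModule) (l + m)).
Proof.
  intros Hh Hk. apply filterlim_C_components in Hh; auto. apply filterlim_C_components in Hk; auto.
  destruct Hh, Hk.
  apply filterlim_C_components; auto; split; apply filterlim_Rplus; auto.
Qed.

Lemma filterlim_Cmult {T : Type} (F : (T -> Prop) -> Prop) {FF : Filter F} (h k : T -> C) (l m : C) :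
  filterlim h F (locally (T := C_R_NormedModule) l) ->
  filterlim k F (locally (T := C_R_NormedModule) m) ->
  filterlim (fun s => h s * k s) F (locally (T := C_R_NormedModule) (l * m)).
Proof.
  intros Hh Hk. apply filterlim_C_components in Hh; auto. apply filterlim_C_components in Hk; auto.
  destruct Hh, Hk.
  apply filterlim_C_components; auto; split;
    repeat (apply filterlim_Rplus || apply filterlim_Ropp || apply filterlim_Rmult); auto.
Qed.

Lemma filterlim_Cinv {T : Type} (F : (T -> Prop) -> Prop) {FF : Filter F} (h : T -> C) (l : C) :
  l <> 0 ->
  filterlim h F (locally (T := C_R_NormedModule) l) ->
  filterlim (fun s => / h s) F (locally (T := C_R_NormedModule) (/ l)).
Proof.
  intros Hl Hh. apply filterlim_C_components in Hh; auto. destruct Hh as [H1 H2].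
  assert (Hn := Cnonzero_sum_sqr _ Hl).
  assert (Hi : filterlim (fun s => / (fst (h s) * (fst (h s) * 1) + snd (h s) * (snd (h s) * 1)))%R F
     (locally (/ (fst l * (fst l * 1) + snd l * (snd l * 1)))%R)).
  { apply (filterlim_comp _ _ _ _ Rinv F
      (locally (fst l * (fst l * 1) + snd l * (snd l * 1))%R)).
    - repeat (apply filterlim_Rplus || apply filterlim_Rmult); auto; apply filterlim_const.
    - apply (continuous_Rinv (fst l * (fst l * 1) + snd l * (snd l * 1))%R). exact Hn. }
  apply filterlim_C_components; auto; split; unfold Cinv; simpl;
    apply filterlim_Rmult; auto. apply filterlim_Ropp; auto.
Qed.

Lemma filterlim_RtoC {T : Type} (F : (T -> Prop) -> Prop) {FF : Filter F} (h : T -> R) (l : R) :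
  filterlim h F (locally l) ->
  filterlim (fun s => RtoC (h s)) F (locally (T := C_R_NormedModule) (RtoC l)).
Proof.
  intros H. apply filterlim_C_components; auto; split; auto. apply filterlim_const.
Qed.

Lemma is_Cderive_continuous (h : R -> C) (x : R) (l : C) :
  is_Cderive h x l -> Ccontinuous h x.
Proof.
  intros H. apply (ex_derive_continuous (V := C_R_NormedModule)). exists l; exact H.
Qed.

Lemma Ccontinuous_mult (h k : R -> C) (x : R) :
  Ccontinuous h x -> Ccontinuous k x -> Ccontinuous (fun s => h s * k s) x.
Proof. intros; apply filterlim_Cmult; auto; apply locally_filter. Qed.

Lemma Ccontinuous_bounded (h : R -> C) (b : R) :
  (forall x, Ccontinuous h x) ->
  exists M, (0 <= M)%R /\ forall x, segment b x -> (Cmod (h x) <= M)%R.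
Proof.
  intros Hh.
  destruct (bounded_continuity (V := C_R_NormedModule) h (- b) b) as [M HM].
  { intros; apply Hh. }
  exists (Rmax 0 M). split; [apply Rmax_l|]. intros x Hx.
  rewrite <- norm_C_R. eapply Rle_trans; [left; apply HM, Hx|apply Rmax_r].
Qed.

Lemma Rdot_le_Cmod (p q : R) (z : C) :
  (p * p + q * q <= 1 -> p * fst z + q * snd z <= Cmod z)%R.
Proof.
  intros H. unfold Cmod.
  apply Rle_trans with (Rabs (p * fst z + q * snd z)); [apply Rle_abs|].
  rewrite <- sqrt_Rsqr_abs. apply sqrt_le_1_alt. unfold Rsqr. simpl.
  assert (0 <= (p * snd z - q * fst z) ^ 2)%R by apply pow2_ge_0.
  assert (0 <= (1 - (p * p + q * q)) * (fst z * fst z + snd z * snd z))%R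
    by (apply Rmult_le_pos; nra).
  nra.
Qed.

Lemma Cmod_mult_self (z : C) : (Cmod z * Cmod z = fst z * fst z + snd z * snd z)%R.
Proof.
  unfold Cmod. rewrite sqrt_sqrt; [ring|]. nra.
Qed.

(** The modulus is the largest inner product with a vector of the unit disc. This
    reduces bounds on complex increments to the real mean value theorem. *)
Lemma Cmod_le_of_dot (z : C) (K : R) :
  (forall p q, p * p + q * q <= 1 -> p * fst z + q * snd z <= K)%R -> (Cmod z <= K)%R.
Proof.
  intros H. destruct (Req_dec (Cmod z) 0) as [E|E].
  - rewrite E. generalize (H 0 0)%R. lra.
  - assert (Q := Cmod_mult_self z). assert (P := Cmod_ge_0 z).
    specialize (H (fst z / Cmod z) (snd z / Cmod z))%R.
    assert (H1 : (fst z / Cmod z * (fst z / Cmod z) + snd z / Cmod z * (snd z / Cmod z) = 1)%R).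
    { replace (_ + _)%R with ((fst z * fst z + snd z * snd z) / (Cmod z * Cmod z))%R by (field; auto).
      rewrite Q. field. rewrite <- Q. nra. }
    assert (H2 : (fst z / Cmod z * fst z + snd z / Cmod z * snd z = Cmod z)%R).
    { replace (_ + _)%R with ((fst z * fst z + snd z * snd z) / Cmod z)%R by (field; auto).
      rewrite <- Q. field; auto. }
    rewrite H1, H2 in H. apply H; lra.
Qed.

(** For every vector [(p, q)] of the unit disc, the real function
    [p Re h + q Im h - k] has a nonpositive derivative, hence does not increase. *)
Lemma Cmod_increment_le (h dh : R -> C) (k dk : R -> R) (S : R) :
  (0 <= S)%R ->
  (forall s, (0 <= s <= S)%R -> is_Cderive h s (dh s)) ->
  (forall s, (0 <= s <= S)%R -> is_derive k s (dk s)) ->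
  (forall s, (0 <= s <= S)%R -> Cmod (dh s) <= dk s)%R ->
  (Cmod (h S - h 0%R) <= k S - k 0)%R.
Proof.
  intros HS Hh Hk Hle. apply Cmod_le_of_dot. intros p q Hpq.
  set (F := (fun s => p * fst (h s) + q * snd (h s) - k s)%R).
  set (dF := (fun s => p * fst (dh s) + q * snd (dh s) - dk s)%R).
  assert (HF : forall s, (0 <= s <= S)%R -> is_derive F s (dF s)).
  { intros s Hs. destruct (proj1 (is_Cderive_components _ _ _) (Hh s Hs)) as [H1 H2].
    apply (is_derive_minus (V := R_NormedModule)); [|apply Hk, Hs].
    apply (is_derive_plus (V := R_NormedModule)); apply is_derive_scal; assumption. }
  destruct (MVT_gen F 0 S dF) as [c [Hc E]].
  - intros s. rewrite Rmin_left, Rmax_right by lra. intros Hs. apply HF; lra.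
  - intros s. rewrite Rmin_left, Rmax_right by lra. intros Hs.
    apply derivable_continuous_pt. exists (dF s). apply is_derive_Reals, HF, Hs.
  - rewrite Rmin_left, Rmax_right in Hc by lra.
    assert (dF c <= 0)%R.
    { unfold dF. generalize (Rdot_le_Cmod p q (dh c) Hpq) (Hle c Hc). lra. }
    unfold F in E. simpl. nra.
Qed.

(** * The segment and its interior *)

Lemma segment_interior (b x : R) : (Rabs x < b)%R -> locally x (segment b).
Proof.
  intros H. apply Rabs_def2 in H.
  assert (Hd : (0 < Rmin (b - x) (x + b))%R) by (apply Rmin_glb_lt; lra).
  exists (mkposreal _ Hd). intros y Hy.
  apply Rabs_lt_between' in Hy. simpl in Hy.
  generalize (Rmin_l (b - x) (x + b)) (Rmin_r (b - x) (x + b)). unfold segment. lra.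
Qed.

Lemma Rabs_lt_locally (b x : R) : (Rabs x < b)%R -> locally x (fun y : R => (Rabs y < b)%R).
Proof.
  intros H. assert (Hd : (0 < b - Rabs x)%R) by lra.
  exists (mkposreal _ Hd). intros y Hy.
  change (Rabs (y - x) < b - Rabs x)%R in Hy.
  generalize (Rabs_triang_inv (y : R) x). lra.
Qed.

Lemma Rabs_lt_segment (b x : R) : (Rabs x < b)%R -> segment b x.
Proof. intros H. apply Rabs_def2 in H. unfold segment. lra. Qed.

Lemma segment_Rabs (b x : R) : segment b x -> (Rabs x <= b)%R.
Proof. intros [H1 H2]. apply Rabs_le. lra. Qed.

Lemma filter_within_segment (b x : R) : Filter (within (segment b) (locally x)).
Proof. apply within_filter, locally_filter. Qed.

(** Near an interior point, restricting the filter to [D] changes nothing. *)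
Lemma is_derive_within_interior {V : NormedModule R_AbsRing} (D : R -> Prop)
    (h : R -> V) (x : R) (l : V) :
  locally x D -> is_derive_within D h x l -> is_derive h x l.
Proof.
  intros HD [Hl Hd]. split; [exact Hl|]. intros y Hy eps.
  assert (Hy' : is_filter_lim (within D (locally x)) y).
  { intros P HP. apply filter_le_within. apply Hy, HP. }
  specialize (Hd y Hy' eps). unfold within in Hd.
  generalize (filter_and _ _ HD Hd). apply filter_imp. intros z [Hz1 Hz2]; auto.
Qed.

Lemma is_derive_within_continuous {V : NormedModule R_AbsRing} (D : R -> Prop)
    (h : R -> V) (x : R) (l : V) :
  is_derive_within D h x l -> filterlim h (within D (locally x)) (locally (h x)).
Proof.
  intros H. apply (filterdiff_continuous_aux (U := R_NormedModule) h).
  - eexists; exact H.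
  - intros P HP. apply filter_le_within, HP.
Qed.

(** Precomposition with this retraction of the line onto the segment extends a
    function that is continuous up to the endpoints to a continuous function on
    the line, without adding zeros. *)
Definition clamp (b x : R) : R := Rmax (- b) (Rmin b x).

Lemma clamp_segment (b x : R) : (0 < b)%R -> segment b (clamp b x).
Proof.
  intros Hb. unfold segment, clamp. split; [apply Rmax_l|].
  apply Rmax_lub; [lra|apply Rmin_l].
Qed.

Lemma clamp_id (b x : R) : segment b x -> clamp b x = x.
Proof. intros [H1 H2]. unfold clamp. rewrite Rmin_right, Rmax_right; lra. Qed.

Lemma clamp_lipschitz (b x y : R) : (Rabs (clamp b y - clamp b x) <= Rabs (y - x))%R.
Proof.
  unfold clamp, Rmin. destruct (Rle_dec b y), (Rle_dec b x);
  unfold Rmax; repeat match goal with |- context [Rle_dec ?p ?q] => destruct (Rle_dec p q) end;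
  unfold Rabs; repeat match goal with |- context [Rcase_abs ?p] => destruct (Rcase_abs p) end; lra.
Qed.

Lemma clamp_continuous {U : UniformSpace} (b x : R) (h : R -> U) :
  (0 < b)%R -> continuous_on (T := R_UniformSpace) (segment b) h ->
  continuous (T := R_UniformSpace) (fun s => h (clamp b s)) x.
Proof.
  intros Hb Hh. apply (filterlim_comp _ _ _ (clamp b) h _ (within (segment b) (locally (clamp b x)))).
  - intros P [d Hd]. exists d. intros y Hy. apply Hd; [|apply clamp_segment, Hb].
    apply Rle_lt_trans with (Rabs (y - x)); [apply clamp_lipschitz|exact Hy].
  - apply Hh, clamp_segment, Hb.
Qed.

(** The points [(1 - eta) x] are interior and tend to [x]. *)
Lemma Cmod_le_closed_segment (b K x : R) (h : R -> C) :
  (0 < b)%R -> segment b x ->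
  filterlim h (within (segment b) (locally x)) (locally (T := C_R_NormedModule) (h x)) ->
  (forall y, (Rabs y < b)%R -> (Cmod (h y) <= K)%R) -> (Cmod (h x) <= K)%R.
Proof.
  intros Hb Hx Hlim HK. apply le_epsilon. intros eps Heps.
  assert (HF : Filter (within (segment b) (locally x))) by apply within_filter, locally_filter.
  destruct (proj1 (filterlim_locally_ball_norm (U := C_R_NormedModule) h (h x)) Hlim
     (mkposreal eps Heps)) as [d Hd].
  assert (Hd0 := cond_pos d). apply segment_Rabs in Hx.
  (* The second bound makes the distance eta |x| smaller than d. *)
  set (eta := Rmin (1 / 2) (d / (2 * b))).
  assert (H1 : (0 < eta)%R) by (apply Rmin_glb_lt; [lra|apply Rdiv_lt_0_compat; lra]).
  assert (H2 : (eta <= 1 / 2)%R) by apply Rmin_l.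
  assert (H3 : (eta * b <= d / 2)%R).
  { apply Rle_trans with (d / (2 * b) * b)%R; [apply Rmult_le_compat_r; [lra|apply Rmin_r]|].
    right; field; lra. }
  assert (P := Rabs_pos x).
  assert (Hy : (Rabs ((1 - eta) * x) < b)%R).
  { rewrite Rabs_mult, (Rabs_pos_eq (1 - eta)) by lra. nra. }
  assert (Hn := Hd ((1 - eta) * x)%R).
  assert (Hb1 : ball x d ((1 - eta) * x)%R).
  { change (Rabs ((1 - eta) * x - x) < d)%R.
    replace ((1 - eta) * x - x)%R with (- (eta * x))%R by ring.
    rewrite Rabs_Ropp, Rabs_mult, (Rabs_pos_eq eta) by lra. nra. }
  specialize (Hn Hb1 (Rabs_lt_segment _ _ Hy)).
  unfold ball_norm in Hn. rewrite norm_C_R in Hn. simpl in Hn.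
  change (Cmod (h ((1 - eta) * x)%R - h x) < eps)%R in Hn.
  assert (T := Cmod_triangle (h ((1 - eta) * x)%R) (- (h ((1 - eta) * x)%R - h x))).
  rewrite Cmod_opp in T.
  replace (h ((1 - eta) * x)%R + - (h ((1 - eta) * x)%R - h x)) with (h x) in T by ring.
  specialize (HK _ Hy). lra.
Qed.

(** * Riemann invariants and the characteristic system *)

(** For [sigma = 1] and [sigma = -1] these are the coordinates of [u + v j] in the
    two idempotents [(1 - j) / 2] and [(1 + j) / 2] of the bicomplex algebra. *)
Definition riemann_invariant (sigma : R) (u v : R -> R -> C) (x t : R) : C :=
  u x t - RtoC sigma * v x t.

Lemma riemann_invariant_sum (sigma : R) (u v : R -> R -> C) (x t : R) :
  riemann_invariant sigma u v x t + riemann_invariant (- sigma) u v x t = 2 * u x t.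
Proof. unfold riemann_invariant. rewrite RtoC_opp. ring. Qed.

(** The Vekua equation in characteristic form. No partial derivative occurs, only
    the derivative along the line of slope [sigma], and only at interior points. *)
Definition characteristic_equations (b : R) (g : R -> C) (u v : R -> R -> C) : Prop :=
  forall sigma x t, (sigma * sigma = 1)%R -> (Rabs x < b)%R -> (Rabs t < b)%R ->
    is_Cderive (fun s => riemann_invariant sigma u v (x + s)%R (t + sigma * s)%R) 0
      (g x * riemann_invariant (- sigma)%R u v x t).

Definition locally_bounded (b : R) (w : R -> R -> C) : Prop :=
  forall r, (r < b)%R -> exists M : R, forall x t,
    (Rabs x <= r)%R -> (Rabs t <= r)%R -> (Cmod (w x t) <= M)%R.

Definition separately_continuous (b : R) (w : R -> R -> C) : Prop :=
  forall x t, square b (x, t) ->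
    filterlim (fun s => w s t) (within (segment b) (locally x))
      (locally (T := C_R_NormedModule) (w x t)) /\
    filterlim (fun s => w x s) (within (segment b) (locally t))
      (locally (T := C_R_NormedModule) (w x t)).

(** What the estimates need besides the equations: local bounds make a supremum
    finite on every smaller square, and continuity in each variable up to the
    boundary carries a bound from the open square to its sides. *)
Definition tame (b : R) (w : R -> R -> C) : Prop :=
  locally_bounded b w /\ separately_continuous b w.

Definition characteristic_solution (b : R) (g : R -> C) (u v : R -> R -> C) : Prop :=
  characteristic_equations b g u v /\ tame b u /\ tame b v.

Lemma tame_plus (b : R) (w1 w2 : R -> R -> C) :
  tame b w1 -> tame b w2 -> tame b (fun x t => w1 x t + w2 x t).
Proof.
  intros [B1 S1] [B2 S2]. split.
  - intros r Hr. destruct (B1 r Hr) as [M1 H1]. destruct (B2 r Hr) as [M2 H2].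
    exists (M1 + M2)%R. intros x t Hx Ht. eapply Rle_trans; [apply Cmod_triangle|].
    apply Rplus_le_compat; auto.
  - intros x t Hxt. destruct (S1 x t Hxt), (S2 x t Hxt).
    split; apply filterlim_Cplus; auto using filter_within_segment.
Qed.

Lemma tame_mult (b : R) (w1 w2 : R -> R -> C) :
  tame b w1 -> tame b w2 -> tame b (fun x t => w1 x t * w2 x t).
Proof.
  intros [B1 S1] [B2 S2]. split.
  - intros r Hr. destruct (B1 r Hr) as [M1 H1]. destruct (B2 r Hr) as [M2 H2].
    exists (M1 * M2)%R. intros x t Hx Ht. rewrite Cmod_mult.
    apply Rmult_le_compat; auto using Cmod_ge_0.
  - intros x t Hxt. destruct (S1 x t Hxt), (S2 x t Hxt).
    split; apply filterlim_Cmult; auto using filter_within_segment.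
Qed.

Lemma tame_of_x (b : R) (h : R -> C) :
  (forall x, Ccontinuous h x) -> tame b (fun x _ => h x).
Proof.
  intros Hh. split.
  - intros r _. destruct (Ccontinuous_bounded h r Hh) as [M [_ HM]].
    exists M. intros x t Hx _. apply HM. apply Rabs_le_between. exact Hx.
  - intros x t _. split; [|apply filterlim_const].
    eapply filterlim_filter_le_1; [|apply Hh]. apply filter_le_within.
Qed.

Lemma tame_of_t (b : R) (h : R -> C) :
  (forall t, Ccontinuous h t) -> tame b (fun _ t => h t).
Proof.
  intros Hh. split.
  - intros r _. destruct (Ccontinuous_bounded h r Hh) as [M [_ HM]].
    exists M. intros x t _ Ht. apply HM. apply Rabs_le_between. exact Ht.
  - intros x t _. split; [apply filterlim_const|].
    eapply filterlim_filter_le_1; [|apply Hh]. apply filter_le_within.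
Qed.

Lemma tame_const (b : R) (c : C) : tame b (fun _ _ => c).
Proof. apply (tame_of_x b (fun _ => c)). intros x. apply filterlim_const. Qed.

Lemma tame_ext (b : R) (w1 w2 : R -> R -> C) :
  (forall x t, w1 x t = w2 x t) -> tame b w1 -> tame b w2.
Proof.
  intros E [B1 S1]. split.
  - intros r Hr. destruct (B1 r Hr) as [M H]. exists M. intros x t. rewrite <- E. apply H.
  - intros x t Hxt. destruct (S1 x t Hxt) as [H1 H2]. rewrite <- E.
    split; eapply filterlim_ext; eauto; intros; simpl; auto.
Qed.

Lemma characteristic_solution_ext (b : R) (g : R -> C) (u1 v1 u2 v2 : R -> R -> C) :
  (forall x t, u1 x t = u2 x t) -> (forall x t, v1 x t = v2 x t) ->
  characteristic_solution b g u1 v1 -> characteristic_solution b g u2 v2.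
Proof.
  intros Eu Ev [H1 [H2 H3]]. split; [|split; eapply tame_ext; eauto].
  intros sigma x t Hs Hx Ht. unfold riemann_invariant. rewrite <- Eu, <- Ev.
  eapply is_derive_ext; [|apply (H1 sigma x t Hs Hx Ht)].
  intros s. unfold riemann_invariant. rewrite Eu, Ev. reflexivity.
Qed.

(** The system is linear with complex coefficients. The difference of two
    solutions is the case [c = -1]. *)
Lemma characteristic_solution_combination (b : R) (g : R -> C) (c : C) (u1 v1 u2 v2 : R -> R -> C) :
  characteristic_solution b g u1 v1 -> characteristic_solution b g u2 v2 ->
  characteristic_solution b g (fun x t => u1 x t + c * u2 x t) (fun x t => v1 x t + c * v2 x t).
Proof.
  intros [H1 [H2 H3]] [K1 [K2 K3]].
  split; [|split; (apply tame_plus; [assumption|apply tame_mult; [apply tame_const|assumption]])].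
  intros sigma x t Hs Hx Ht.
  specialize (H1 sigma x t Hs Hx Ht). specialize (K1 sigma x t Hs Hx Ht).
  apply is_derive_ext with (fun s => plus (G := C_R_NormedModule)
     (riemann_invariant sigma u1 v1 (x + s)%R (t + sigma * s)%R)
     (c * riemann_invariant sigma u2 v2 (x + s)%R (t + sigma * s)%R)).
  { intros s. unfold riemann_invariant.
    match goal with |- plus ?p ?q = ?r => change (p + q = r) end. ring. }
  replace (g x * riemann_invariant (- sigma) (fun x t => u1 x t + c * u2 x t) (fun x t => v1 x t + c * v2 x t) x t)
    with (plus (G := C_R_NormedModule) (g x * riemann_invariant (- sigma) u1 v1 x t)
      (0 * riemann_invariant sigma u2 v2 (x + 0)%R (t + sigma * 0)%R
        + c * (g x * riemann_invariant (- sigma) u2 v2 x t))).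
  2:{ unfold riemann_invariant. match goal with |- plus ?p ?q = ?r => change (p + q = r) end. ring. }
  apply (is_derive_plus (V := C_R_NormedModule)); [exact H1|].
  apply (is_Cderive_mult (fun _ => c)
    (fun s => riemann_invariant sigma u2 v2 (x + s)%R (t + sigma * s)%R)); [|exact K1].
  apply (is_derive_const (V := C_R_NormedModule)).
Qed.

(** * Solutions of the Vekua equation solve the characteristic system *)

(** A partial derivative that exists near the point and is continuous there,
    together with the other partial derivative at the point, gives total
    differentiability, hence both the chain rule along a line and joint continuity. *)
Lemma filterdiff_line (c cx : R -> R -> R) (ct x t sigma : R) :
  locally (x, t) (fun p : R * R => is_derive (fun z => c z (snd p)) (fst p) (cx (fst p) (snd p))) ->
  is_derive (fun z => c x z) t ct ->
  continuous (fun p : R * R => cx (fst p) (snd p)) (x, t) ->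
  is_derive (fun s => c (x + s)%R (t + sigma * s)%R) 0%R (cx x t + sigma * ct)%R
  /\ continuity_2d_pt c x t.
Proof.
  intros Hx Ht Hc. generalize (is_derive_filterdiff c x t cx ct Hx Ht Hc). intros Hd.
  split.
  - assert (H1 : filterdiff (K := R_AbsRing) (U := R_NormedModule) (V := R_NormedModule)
        (fun s : R => (x + s)%R) (locally 0%R) (fun h => scal h 1%R)).
    { change (is_derive (fun s : R => (x + s)%R) 0%R 1%R). auto_derive; auto. }
    assert (H2 : filterdiff (K := R_AbsRing) (U := R_NormedModule) (V := R_NormedModule)
        (fun s : R => (t + sigma * s)%R) (locally 0%R) (fun h => scal h sigma)).
    { change (is_derive (fun s : R => (t + sigma * s)%R) 0%R sigma). auto_derive; auto; ring. }
    generalize (filterdiff_comp'_2 (T := R_NormedModule) (U := R_NormedModule) (V := R_NormedModule)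
      (W := R_NormedModule) (fun s : R => (x + s)%R) (fun s : R => (t + sigma * s)%R) c 0%R
      _ _ (fun h k => plus (scal h (cx x t)) (scal k ct)) H1 H2).
    intros H3. eapply filterdiff_ext_lin.
    + apply H3. rewrite Rmult_0_r, !Rplus_0_r. exact Hd.
    + intros y. unfold scal, plus; simpl; unfold mult; simpl. ring.
  - apply continuity_2d_pt_filterlim.
    apply (filterdiff_continuous (fun u : R * R => c (fst u) (snd u)) (x, t)).
    eexists; exact Hd.
Qed.

(** Uniform continuity with modulus [1] at scale [d] lets the function grow by at
    most [1] whenever the square is enlarged by [d / 2]. *)
Lemma continuity_2d_bounded (c : R -> R -> R) (r : R) :
  (forall x t, (Rabs x <= r)%R -> (Rabs t <= r)%R -> continuity_2d_pt c x t) ->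
  exists M : R, forall x t, (Rabs x <= r)%R -> (Rabs t <= r)%R -> (Rabs (c x t) <= M)%R.
Proof.
  intros Hc.
  destruct (uniform_continuity_2d c (- r) r (- r) r) with (eps := mkposreal 1 Rlt_0_1) as [d Hd].
  { intros x y Hx Hy. apply Hc; apply Rabs_le; lra. }
  assert (Hd0 := cond_pos d).
  assert (Hn : forall n x t, (Rabs x <= r)%R -> (Rabs t <= r)%R ->
     (Rabs x <= INR n * (d / 2))%R -> (Rabs t <= INR n * (d / 2))%R ->
     (Rabs (c x t) <= Rabs (c 0 0) + INR n)%R).
  { induction n as [|n IH]; intros x t Hx Ht Hxn Htn.
    - simpl in Hxn, Htn. rewrite Rmult_0_l in Hxn, Htn.
      assert (x = 0%R) by (destruct (Req_dec x 0); auto; generalize (Rabs_pos_lt x H); lra).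
      assert (t = 0%R) by (destruct (Req_dec t 0); auto; generalize (Rabs_pos_lt t H0); lra).
      subst. simpl. lra.
    - rewrite S_INR in *. assert (Hp := pos_INR n).
      (* Scaling by n / (n + 1) brings the point into the smaller square and moves it
         by at most d / 2. *)
      set (q := (INR n / (INR n + 1))%R).
      assert (Hq : (0 <= q <= 1)%R).
      { unfold q; split; [apply Rdiv_le_0_compat; lra|].
        apply (Rmult_le_reg_r (INR n + 1)); [lra|]. field_simplify; lra. }
      assert (Hq1 : forall y, (Rabs y <= r)%R -> (Rabs y <= (INR n + 1) * (d / 2))%R ->
          (Rabs (q * y) <= r)%R /\ (Rabs (q * y) <= INR n * (d / 2))%R /\ (Rabs (q * y - y) < d)%R).
      { intros y Hy1 Hy2. assert (P := Rabs_pos y). repeat split.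
        - rewrite Rabs_mult, (Rabs_pos_eq q) by lra. nra.
        - rewrite Rabs_mult, (Rabs_pos_eq q) by lra.
          replace (INR n * (d / 2))%R with (q * ((INR n + 1) * (d / 2)))%R by (unfold q; field; lra).
          apply Rmult_le_compat_l; lra.
        - replace (q * y - y)%R with (- (/ (INR n + 1) * y))%R by (unfold q; field; lra).
          rewrite Rabs_Ropp, Rabs_mult, Rabs_pos_eq by (left; apply Rinv_0_lt_compat; lra).
          apply Rle_lt_trans with (/ (INR n + 1) * ((INR n + 1) * (d / 2)))%R.
          + apply Rmult_le_compat_l; [left; apply Rinv_0_lt_compat; lra|exact Hy2].
          + rewrite <- Rmult_assoc, Rinv_l by lra. lra. }
      destruct (Hq1 x Hx Hxn) as [X1 [X2 X3]]. destruct (Hq1 t Ht Htn) as [T1 [T2 T3]].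
      specialize (IH (q * x)%R (q * t)%R X1 T1 X2 T2).
      assert (L : (Rabs (c (q * x) (q * t) - c x t) < 1)%R).
      { apply Hd; auto; apply Rabs_le_between; auto. }
      generalize (Rabs_triang_inv (c x t) (c (q * x) (q * t))%R).
      rewrite Rabs_minus_sym in L. lra. }
  destruct (nfloor_ex (Rmax 0 (r / (d / 2)))) as [n [_ Hn2]]; [apply Rmax_l|].
  exists (Rabs (c 0 0) + INR (S n))%R. intros x t Hx Ht.
  assert (Hr : (r <= INR (S n) * (d / 2))%R).
  { rewrite S_INR. apply (Rmult_le_reg_r (/ (d / 2))); [apply Rinv_0_lt_compat; lra|].
    rewrite Rmult_assoc, Rinv_r, Rmult_1_r by lra.
    generalize (Rmax_r 0 (r / (d / 2))). unfold Rdiv at 1 3. lra. }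
  apply Hn; lra.
Qed.

(** Stated for a real-valued linear [L], so that it covers the four real
    components of a bicomplex function at once. *)
Lemma C1_on_square_derive_line (L : bicomplex -> R) (b : R) (W Wx Wt : R -> R -> bicomplex) (sigma x t : R) :
  is_linear (K := R_AbsRing) (U := B_NormedModule) (V := R_NormedModule) L ->
  C1_on_square b W Wx Wt -> (Rabs x < b)%R -> (Rabs t < b)%R ->
  is_derive (fun s => L (W (x + s)%R (t + sigma * s)%R)) 0%R (L (Wx x t) + sigma * L (Wt x t))%R
  /\ continuity_2d_pt (fun x t => L (W x t)) x t.
Proof.
  intros HL [Hd [HcX _]] Hx Ht.
  assert (Hlin : forall (h : R -> bicomplex) (y : R) (l : bicomplex),
     (Rabs y < b)%R -> is_derive_within (V := B_NormedModule) (segment b) h y l ->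
     is_derive (fun s => L (h s)) y (L l)).
  { intros h y l Hy Hh. apply is_derive_within_interior in Hh; [|apply segment_interior, Hy].
    eapply filterdiff_ext_lin.
    - apply (filterdiff_comp' (U := R_NormedModule) (V := B_NormedModule) (W := R_NormedModule)
        h L y _ L Hh). apply filterdiff_linear, HL.
    - intros k. cbv beta. apply (linear_scal _ HL). }
  apply (filterdiff_line (fun x t => L (W x t)) (fun x t => L (Wx x t)) (L (Wt x t)) x t sigma).
  - assert (Hx1 := Rabs_lt_locally _ _ Hx). assert (Ht1 := Rabs_lt_locally _ _ Ht).
    destruct Hx1 as [d1 H1], Ht1 as [d2 H2].
    assert (Hd0 : (0 < Rmin d1 d2)%R) by (apply Rmin_glb_lt; apply cond_pos).
    exists (mkposreal _ Hd0). intros [y s] [Hy Hs]. simpl in *.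
    assert (Hy' : (Rabs y < b)%R).
    { apply H1. eapply ball_le; [|exact Hy]. apply Rmin_l. }
    assert (Hs' : (Rabs s < b)%R).
    { apply H2. eapply ball_le; [|exact Hs]. apply Rmin_r. }
    apply (Hlin (fun z => W z s) y (Wx y s) Hy'). apply Hd.
    split; apply Rabs_lt_segment; assumption.
  - apply (Hlin (fun z => W x z) t (Wt x t) Ht). apply Hd.
    split; apply Rabs_lt_segment; assumption.
  - assert (Hsq : square b (x, t)) by (split; apply Rabs_lt_segment; assumption).
    specialize (HcX (x, t) Hsq).
    assert (Hloc : locally (T := prod_UniformSpace R_UniformSpace R_UniformSpace) (x, t) (square b)).
    { destruct (segment_interior _ _ Hx) as [d1 H1], (segment_interior _ _ Ht) as [d2 H2].
      assert (Hd0 : (0 < Rmin d1 d2)%R) by (apply Rmin_glb_lt; apply cond_pos).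
      exists (mkposreal _ Hd0). intros [y s] [Hy Hs]. split.
      - apply H1. eapply ball_le; [|exact Hy]. apply Rmin_l.
      - apply H2. eapply ball_le; [|exact Hs]. apply Rmin_r. }
    assert (HcX' : filterlim (fun p : R * R => Wx (fst p) (snd p))
        (locally (T := prod_UniformSpace R_UniformSpace R_UniformSpace) (x, t))
        (locally (T := B_NormedModule) (Wx x t))).
    { intros P HP. specialize (HcX P HP). unfold filtermap, within in *.
      generalize (filter_and _ _ Hloc HcX). apply filter_imp. intros z [Hz1 Hz2]; auto. }
    apply (filterlim_comp _ _ _ _ L _ _ _ HcX').
    apply (filterdiff_continuous (U := B_NormedModule) (V := R_NormedModule) L).
    exists L. apply filterdiff_linear, HL.
Qed.

Lemma C1_on_square_regular (b : R) (u v : R -> R -> C) (Wx Wt : R -> R -> bicomplex) :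
  C1_on_square b (fun x t => (u x t, v x t)) Wx Wt ->
  (forall sigma x t, (Rabs x < b)%R -> (Rabs t < b)%R ->
    is_Cderive (fun s => u (x + s)%R (t + sigma * s)%R) 0%R
      (fst (Wx x t) + RtoC sigma * fst (Wt x t)) /\
    is_Cderive (fun s => v (x + s)%R (t + sigma * s)%R) 0%R
      (snd (Wx x t) + RtoC sigma * snd (Wt x t))) /\
  (locally_bounded b u /\ locally_bounded b v) /\
  (separately_continuous b u /\ separately_continuous b v).
Proof.
  intros HC.
  set (Cn := C_R_NormedModule).
  assert (L1 : is_linear (K := R_AbsRing) (U := B_NormedModule) (V := Cn) (fun w => fst w))
    by apply (is_linear_fst (U := Cn) (V := Cn)).
  assert (L2 : is_linear (K := R_AbsRing) (U := B_NormedModule) (V := Cn) (fun w => snd w))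
    by apply (is_linear_snd (U := Cn) (V := Cn)).
  assert (R1 : is_linear (K := R_AbsRing) (U := Cn) (V := R_NormedModule) (fun w => fst w))
    by apply (is_linear_fst (U := R_NormedModule) (V := R_NormedModule)).
  assert (R2 : is_linear (K := R_AbsRing) (U := Cn) (V := R_NormedModule) (fun w => snd w))
    by apply (is_linear_snd (U := R_NormedModule) (V := R_NormedModule)).
  assert (L11 := is_linear_comp _ _ L1 R1). assert (L12 := is_linear_comp _ _ L1 R2).
  assert (L21 := is_linear_comp _ _ L2 R1). assert (L22 := is_linear_comp _ _ L2 R2).
  assert (Hsum : forall (p q : C) (s : R), (fst p + s * fst q)%R = fst (p + RtoC s * q)
     /\ (snd p + s * snd q)%R = snd (p + RtoC s * q)).
  { intros p q s; simpl; split; ring. }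
  split; [|split].
  - intros sigma x t Hx Ht.
    destruct (C1_on_square_derive_line _ b _ _ _ sigma x t L11 HC Hx Ht) as [D11 _].
    destruct (C1_on_square_derive_line _ b _ _ _ sigma x t L12 HC Hx Ht) as [D12 _].
    destruct (C1_on_square_derive_line _ b _ _ _ sigma x t L21 HC Hx Ht) as [D21 _].
    destruct (C1_on_square_derive_line _ b _ _ _ sigma x t L22 HC Hx Ht) as [D22 _].
    split; apply is_Cderive_components; split;
      rewrite <- ?(proj1 (Hsum _ _ _)), <- ?(proj2 (Hsum _ _ _)); assumption.
  - assert (Hb : forall w : R -> R -> C,
      (forall x t, (Rabs x < b)%R -> (Rabs t < b)%R -> continuity_2d_pt (fun x t => fst (w x t)) x t) ->
      (forall x t, (Rabs x < b)%R -> (Rabs t < b)%R -> continuity_2d_pt (fun x t => snd (w x t)) x t) ->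
      locally_bounded b w).
    { intros w H1 H2 r Hr.
      destruct (continuity_2d_bounded (fun x t => fst (w x t)) r) as [M1 HM1].
      { intros; apply H1; lra. }
      destruct (continuity_2d_bounded (fun x t => snd (w x t)) r) as [M2 HM2].
      { intros; apply H2; lra. }
      exists (M1 + M2)%R. intros x t Hx Ht.
      specialize (HM1 x t Hx Ht). specialize (HM2 x t Hx Ht). simpl in HM1, HM2.
      assert (Q := Cmod_mult_self (w x t)). assert (P := Cmod_ge_0 (w x t)).
      assert (A1 := Rabs_pos (fst (w x t))). assert (A2 := Rabs_pos (snd (w x t))).
      assert (B1 := pow2_abs (fst (w x t))). assert (B2 := pow2_abs (snd (w x t))).
      simpl in B1, B2.
      apply Rle_trans with (Rabs (fst (w x t)) + Rabs (snd (w x t)))%R; [|lra].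
      apply Rsqr_incr_0_var; [|lra]. unfold Rsqr. nra. }
    split; apply Hb; intros x t Hx Ht.
    + exact (proj2 (C1_on_square_derive_line _ b _ _ _ 0%R x t L11 HC Hx Ht)).
    + exact (proj2 (C1_on_square_derive_line _ b _ _ _ 0%R x t L12 HC Hx Ht)).
    + exact (proj2 (C1_on_square_derive_line _ b _ _ _ 0%R x t L21 HC Hx Ht)).
    + exact (proj2 (C1_on_square_derive_line _ b _ _ _ 0%R x t L22 HC Hx Ht)).
  - destruct HC as [Hd _].
    assert (Hc1 : forall z : B_NormedModule, filterlim (fun w : bicomplex => fst w)
       (locally z) (locally (T := Cn) (fst z))).
    { intros z. apply (filterdiff_continuous (U := B_NormedModule) (V := Cn) (fun w => fst w)).
      eexists; apply filterdiff_linear, L1. }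
    assert (Hc2 : forall z : B_NormedModule, filterlim (fun w : bicomplex => snd w)
       (locally z) (locally (T := Cn) (snd z))).
    { intros z. apply (filterdiff_continuous (U := B_NormedModule) (V := Cn) (fun w => snd w)).
      eexists; apply filterdiff_linear, L2. }
    split; intros x t Hxt; destruct (Hd x t Hxt) as [Dx Dt];
      apply is_derive_within_continuous in Dx; apply is_derive_within_continuous in Dt; split.
    + exact (filterlim_comp _ _ _ _ _ _ _ _ Dx (Hc1 _)).
    + exact (filterlim_comp _ _ _ _ _ _ _ _ Dt (Hc1 _)).
    + exact (filterlim_comp _ _ _ _ _ _ _ _ Dx (Hc2 _)).
    + exact (filterlim_comp _ _ _ _ _ _ _ _ Dt (Hc2 _)).
Qed.

(** Separated into its two components the Vekua equation reads
    [u_x - v_t = g u] and [v_x - u_t = - g v] with [g = f' / f]. The derivative of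
    [u - sigma v] in the direction [(1, sigma)] is
    [(u_x - sigma^2 v_t) - sigma (v_x - u_t)], which equals [g (u + sigma v)]
    because [sigma^2 = 1]. *)
Lemma vekua_characteristic_solution (b : R) (f f1 : R -> C) (u v : R -> R -> C) :
  (forall x, segment b x -> f x <> 0) ->
  vekua_solution b f f1 (fun x t => (u x t, v x t)) ->
  characteristic_solution b (fun x => f1 x / f x) u v.
Proof.
  intros Hf [Wx [Wt [HC Heq]]].
  destruct (C1_on_square_regular b u v Wx Wt HC) as [Hline Hreg].
  destruct Hreg as [[Bu Bv] [Su Sv]]. split; [|split; split; assumption].
  intros sigma x t Hs Hx Ht.
  destruct (Hline sigma x t Hx Ht) as [Du Dv].
  assert (Hsx := Rabs_lt_segment _ _ Hx). assert (Hst := Rabs_lt_segment _ _ Ht).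
  specialize (Heq x t (conj Hsx Hst)). specialize (Hf x Hsx).
  destruct (Wx x t) as [ux vx], (Wt x t) as [ut vt].
  unfold dbar, Bminus, Bmult, CtoB, Bj, Bconj in Heq. simpl in Heq, Du, Dv.
  apply (f_equal (fun w => (2 * fst w, 2 * snd w))) in Heq. simpl fst in Heq; simpl snd in Heq.
  assert (E1 : ux - vt = f1 x / f x * u x t).
  { apply (f_equal fst) in Heq. cbn [fst] in Heq.
    apply (f_equal (fun z => z + f1 x / f x * u x t)) in Heq.
    match type of Heq with ?l = ?r => transitivity l; [|transitivity r] end.
    - field. assumption.
    - exact Heq.
    - ring. }
  assert (E2 : vx - ut = - (f1 x / f x * v x t)).
  { apply (f_equal snd) in Heq. cbn [snd] in Heq.
    apply (f_equal (fun z => z - f1 x / f x * v x t)) in Heq.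
    match type of Heq with ?l = ?r => transitivity l; [|transitivity r] end.
    - field. assumption.
    - exact Heq.
    - ring. }
  assert (Hs' : RtoC sigma * RtoC sigma = 1) by (rewrite <- RtoC_mult, Hs; reflexivity).
  unfold riemann_invariant.
  replace (f1 x / f x * (u x t - RtoC (- sigma) * v x t)) with
    ((ux + RtoC sigma * ut) + (RtoC (- sigma) * (vx + RtoC sigma * vt))).
  2:{ rewrite RtoC_opp.
      transitivity ((ux - (RtoC sigma * RtoC sigma) * vt) - RtoC sigma * (vx - ut)); [ring|].
      rewrite Hs', E2. replace (ux - 1 * vt) with (ux - vt) by ring. rewrite E1. ring. }
  apply is_derive_ext with
    (fun s => plus (G := C_R_NormedModule) (u (x + s)%R (t + sigma * s)%R)
       (RtoC (- sigma) * v (x + s)%R (t + sigma * s)%R)).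
  { intros s. rewrite RtoC_opp. unfold plus; simpl.
    match goal with |- _ = ?r => transitivity (u (x + s)%R (t + sigma * s)%R + - RtoC sigma * v (x + s)%R (t + sigma * s)%R); [reflexivity|ring] end. }
  apply (is_derive_plus (V := C_R_NormedModule)); [exact Du|].
  replace (RtoC (- sigma) * (vx + RtoC sigma * vt)) with
    (0 * v (x + 0)%R (t + sigma * 0)%R + RtoC (- sigma) * (vx + RtoC sigma * vt)) by ring.
  apply (is_Cderive_mult (fun _ => RtoC (- sigma)) (fun s => v (x + s)%R (t + sigma * s)%R)); auto.
  apply (is_derive_const (V := C_R_NormedModule)).
Qed.

(** * Continuous dependence on the traces on the diagonals *)

Lemma Rmax_Rabs_plus_minus (p q : R) :
  (Rmax (Rabs (p + q)) (Rabs (p - q)) = Rabs p + Rabs q)%R.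
Proof.
  unfold Rmax. destruct (Rle_dec _ _); revert r || revert n;
  unfold Rabs; destruct (Rcase_abs _); destruct (Rcase_abs _);
  destruct (Rcase_abs _); destruct (Rcase_abs _); lra.
Qed.

Lemma unit_sign (s : R) : (s * s = 1)%R -> (s = 1 \/ s = -1)%R.
Proof.
  intros H. assert (E : ((s - 1) * (s + 1) = 0)%R) by lra.
  destruct (Rmult_integral _ _ E); [left|right]; lra.
Qed.

(** The square is a ball for the sum of the absolute values of the two
    characteristic coordinates. In particular it contains the characteristic
    segments that join a point to the diagonals. *)
Lemma Rmax_Rabs_characteristic_coordinates (sigma x t : R) :
  (sigma * sigma = 1)%R ->
  (Rmax (Rabs x) (Rabs t) = Rabs ((x - sigma * t) / 2) + Rabs ((x + sigma * t) / 2))%R.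
Proof.
  intros Hs. rewrite <- Rmax_Rabs_plus_minus.
  replace ((x - sigma * t) / 2 + (x + sigma * t) / 2)%R with x by field.
  replace ((x - sigma * t) / 2 - (x + sigma * t) / 2)%R with (- (sigma * t))%R by field.
  rewrite Rabs_Ropp. f_equal. destruct (unit_sign _ Hs); subst.
  - f_equal; ring.
  - rewrite <- Rabs_Ropp. f_equal; ring.
Qed.

(** A Gronwall argument. Let [m] be the supremum of [|A sigma|] divided by the
    weight [exp (2 G rho)], where [rho = Rmax |x| |t|], over a closed square inside
    the open one. Moving along a characteristic away from the diagonal, [rho] grows
    with unit speed, so the integral of [G m exp (2 G rho)] is at most
    [m / 2] times the weight. Hence [m <= K + m / 2], that is [m <= 2 K]. *)
Lemma goursat_estimate (b G K : R) (g : R -> C) (A : R -> R -> R -> C) :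
  (0 < G)%R ->
  (forall x, Rabs x < b -> Cmod (g x) <= G)%R ->
  (forall sigma x t, (sigma * sigma = 1)%R -> (Rabs x < b)%R -> (Rabs t < b)%R ->
     is_Cderive (fun s => A sigma (x + s)%R (t + sigma * s)%R) 0
       (g x * A (- sigma)%R x t)) ->
  (forall r, (r < b)%R -> exists M : R, forall sigma x t, (sigma * sigma = 1)%R ->
     (Rabs x <= r)%R -> (Rabs t <= r)%R -> (Cmod (A sigma x t) <= M)%R) ->
  (forall sigma y, (sigma * sigma = 1)%R -> (Rabs y < b)%R ->
     (Cmod (A sigma y (- sigma * y)%R) <= K)%R) ->
  forall sigma x t, (sigma * sigma = 1)%R -> (Rabs x < b)%R -> (Rabs t < b)%R ->
     (Cmod (A sigma x t) <= 2 * K * exp (2 * G * b))%R.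
Proof.
  intros HG Hg HA Hbd HK sigma1 x1 t1 Hs1 Hx1 Ht1.
  set (r := Rmax (Rabs x1) (Rabs t1)).
  assert (Hr : (r < b)%R) by (apply Rmax_lub_lt; assumption).
  assert (Hr0 : (0 <= r)%R) by (eapply Rle_trans; [apply (Rabs_pos x1)|apply Rmax_l]).
  destruct (Hbd r Hr) as [M HM].
  set (w := fun x t : R => exp (2 * G * Rmax (Rabs x) (Rabs t))).
  assert (Hw : forall x t, (1 <= w x t)%R).
  { intros x t. unfold w. rewrite <- exp_0.
    assert (0 <= Rmax (Rabs x) (Rabs t))%R
      by (eapply Rle_trans; [apply (Rabs_pos x)|apply Rmax_l]).
    destruct (Rle_lt_or_eq_dec 0 (2 * G * Rmax (Rabs x) (Rabs t)))%R as [L|L]; [nra| |].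
    - left; apply exp_increasing, L.
    - rewrite <- L; right; reflexivity. }
  (* The weighted moduli whose supremum m is estimated. *)
  set (E := fun y => exists sigma x t, (sigma * sigma = 1)%R /\ (Rabs x <= r)%R /\
      (Rabs t <= r)%R /\ y = (Cmod (A sigma x t) / w x t)%R).
  assert (Hdiv : forall sigma x t, (Cmod (A sigma x t) / w x t <= Cmod (A sigma x t))%R).
  { intros s x t. generalize (Hw x t) (Cmod_ge_0 (A s x t)); intros W P.
    apply (Rmult_le_reg_r (w x t)); [lra|]. field_simplify; [nra|lra]. }
  destruct (completeness E) as [m [Hm1 Hm2]].
  - exists M. intros y [s [x [t [Hs [Hx [Ht ->]]]]]].
    eapply Rle_trans; [apply Hdiv|]. apply HM; assumption.
  - exists (Cmod (A sigma1 x1 t1) / w x1 t1)%R, sigma1, x1, t1.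
    repeat split; auto; [apply Rmax_l|apply Rmax_r].
  - assert (Hm : forall sigma x t, (sigma * sigma = 1)%R -> (Rabs x <= r)%R -> (Rabs t <= r)%R ->
       (Cmod (A sigma x t) <= m * w x t)%R).
    { intros s x t Hs Hx Ht.
      assert (L : (Cmod (A s x t) / w x t <= m)%R)
        by (apply Hm1; exists s, x, t; auto).
      generalize (Hw x t); intros W.
      apply (Rmult_le_compat_r (w x t)) in L; [|lra].
      unfold Rdiv in L. rewrite Rmult_assoc, Rinv_l, Rmult_1_r in L; lra. }
    assert (Hm0 : (0 <= m)%R).
    { eapply Rle_trans; [|apply Hm1; exists sigma1, x1, t1; repeat split; auto; [apply Rmax_l|apply Rmax_r]].
      apply Rdiv_le_0_compat; [apply Cmod_ge_0|generalize (Hw x1 t1); lra]. }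
    assert (Hm3 : (m <= K + m / 2)%R).
    { apply Hm2. intros y [sigma [x [t [Hs [Hx [Ht ->]]]]]].
      (* The characteristic of direction (1, sigma) through (x, t) leaves the diagonal
         at (y0, - sigma y0) and reaches (x, t) after the signed time S; the sign tau
         lets the path be run over nonnegative times. *)
      set (y0 := ((x - sigma * t) / 2)%R). set (S := ((x + sigma * t) / 2)%R).
      assert (Hrect : Rmax (Rabs x) (Rabs t) = (Rabs y0 + Rabs S)%R)
        by (apply Rmax_Rabs_characteristic_coordinates; auto).
      assert (HyS : (Rabs y0 + Rabs S <= r)%R) by (rewrite <- Hrect; apply Rmax_lub; auto).
      assert (Htau : exists tau, (tau * tau = 1 /\ tau * Rabs S = S)%R).
      { destruct (Rle_dec 0 S); [exists 1%R; rewrite Rabs_pos_eq by lra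
                                |exists (-1)%R; rewrite Rabs_left by lra]; lra. }
      destruct Htau as [tau [Htau HtS]].
      set (X := fun s : R => (y0 + tau * s)%R).
      set (T := fun s : R => (- sigma * y0 + sigma * tau * s)%R).
      assert (HXT : forall s, (0 <= s)%R -> Rmax (Rabs (X s)) (Rabs (T s)) = (Rabs y0 + s)%R).
      { intros s Hs0. rewrite (Rmax_Rabs_characteristic_coordinates sigma) by auto.
        replace ((X s - sigma * T s) / 2)%R with (y0 * (1 + sigma * sigma) / 2 + tau * s * (1 - sigma * sigma) / 2)%R
          by (unfold X, T; field).
        replace ((X s + sigma * T s) / 2)%R with (y0 * (1 - sigma * sigma) / 2 + tau * s * (1 + sigma * sigma) / 2)%R
          by (unfold X, T; field).
        rewrite Hs. f_equal; [f_equal; field|].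
        replace (_ + _)%R with (tau * s)%R by field. rewrite Rabs_mult, (Rabs_pos_eq s) by auto.
        destruct (unit_sign _ Htau); subst tau; [rewrite Rabs_R1|rewrite Rabs_m1]; ring. }
      assert (HX : forall s, (0 <= s <= Rabs S)%R -> (Rabs (X s) <= r)%R).
      { intros s Hs0. eapply Rle_trans; [apply Rmax_l|]. rewrite HXT by lra. lra. }
      assert (HT : forall s, (0 <= s <= Rabs S)%R -> (Rabs (T s) <= r)%R).
      { intros s Hs0. eapply Rle_trans; [apply Rmax_r|]. rewrite HXT by lra. lra. }
      assert (Hstep := Cmod_increment_le (fun s => A sigma (X s) (T s))
         (fun s => scal (V := C_R_NormedModule) tau (g (X s) * A (- sigma)%R (X s) (T s)))
         (fun s => m / 2 * exp (2 * G * (Rabs y0 + s)))%R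
         (fun s => G * (m * exp (2 * G * (Rabs y0 + s))))%R (Rabs S) (Rabs_pos S)).
      cbv beta in Hstep.
      replace (X 0%R) with y0 in Hstep by (unfold X; ring).
      replace (T 0%R) with (- sigma * y0)%R in Hstep by (unfold T; ring).
      replace (X (Rabs S)) with x in Hstep
        by (unfold X; rewrite HtS; unfold y0, S; field).
      replace (T (Rabs S)) with t in Hstep.
      2:{ unfold T. rewrite Rmult_assoc, HtS. unfold y0, S.
          replace (_ + _)%R with (sigma * sigma * t)%R by field. rewrite Hs; ring. }
      (* The comparison function m / 2 exp (2 G (|y0| + s)) has derivative
         G m exp (2 G (|y0| + s)), which dominates |g| |A (- sigma)|. *)
      assert (HI : (Cmod (A sigma x t) <= K + m / 2 * w x t)%R).
      { assert (HK0 : (Cmod (A sigma y0 (- sigma * y0)%R) <= K)%R).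
        { apply HK; auto. generalize (Rabs_pos S); lra. }
        assert (Htri : (Cmod (A sigma x t) <= Cmod (A sigma x t - A sigma y0 (- sigma * y0)%R)
                   + Cmod (A sigma y0 (- sigma * y0)%R))%R).
        { eapply Rle_trans; [|apply Cmod_triangle]. right; f_equal; ring. }
        unfold w. rewrite Hrect.
        assert (0 <= m / 2 * exp (2 * G * (Rabs y0 + 0)))%R
          by (apply Rmult_le_pos; [lra|left; apply exp_pos]).
        enough (Hgoal : (Cmod (A sigma x t - A sigma y0 (- sigma * y0)%R) <=
             m / 2 * exp (2 * G * (Rabs y0 + Rabs S)) - m / 2 * exp (2 * G * (Rabs y0 + 0)))%R) by lra.
        apply Hstep.
        - intros s Hs0.
          apply is_derive_ext with (fun s' => A sigma (X s + tau * (s' - s))%R (T s + sigma * (tau * (s' - s)))%R).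
          { intros s'. simpl. unfold X, T. f_equal; ring. }
          apply (is_derive_comp (V := C_R_NormedModule)
             (fun s' => A sigma (X s + s')%R (T s + sigma * s')%R) (fun s' => tau * (s' - s))%R).
          + replace (tau * (s - s))%R with 0%R by ring.
            apply HA; auto; [apply Rle_lt_trans with r; auto..].
          + auto_derive; auto; ring.
        - intros s _. auto_derive; auto. field.
        - intros s Hs0. rewrite scal_R_Cmult, 2!Cmod_mult, Cmod_R.
          replace (Rabs tau) with 1%R.
          2:{ destruct (unit_sign _ Htau); subst tau; [rewrite Rabs_R1|rewrite Rabs_m1]; auto. }
          rewrite Rmult_1_l. apply Rmult_le_compat; try apply Cmod_ge_0.
          + apply Hg. apply Rle_lt_trans with r; auto.
          + rewrite <- HXT by lra. apply Hm; auto. rewrite <- Hs; ring. }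
      generalize (Hw x t); intros W.
      apply (Rmult_le_reg_r (w x t)); [lra|].
      unfold Rdiv at 1. rewrite Rmult_assoc, Rinv_l, Rmult_1_r by lra.
      assert (0 <= K)%R.
      { eapply Rle_trans; [apply Cmod_ge_0|apply (HK sigma 0%R Hs)].
        rewrite Rabs_R0; lra. }
      nra. }
    eapply Rle_trans; [apply (Hm sigma1 x1 t1); auto; [apply Rmax_l|apply Rmax_r]|].
    apply Rmult_le_compat; try lra.
    + left; apply exp_pos.
    + unfold w. fold r.
      destruct (Rle_lt_or_eq_dec (2 * G * r) (2 * G * b))%R as [L|L]; [nra| |].
      * left; apply exp_increasing, L.
      * rewrite L; right; reflexivity.
Qed.

(** On the diagonal of direction [(1, tau)] the invariant [A tau] is differentiated
    along its characteristic, and [A (- tau) = 2 u - A tau]. Therefore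
    [(f A tau)' = f' A tau + f' (2 u - A tau) = 2 f' u]. *)
Lemma diagonal_estimate (b L F1 eps : R) (f f1 : R -> C) (u v : R -> R -> C) :
  (0 <= L)%R -> (0 <= F1)%R ->
  (forall x, (Rabs x < b)%R -> f x <> 0 /\ is_Cderive f x (f1 x) /\
     (Cmod (/ f x) <= L)%R /\ (Cmod (f1 x) <= F1)%R) ->
  f 0%R = 1 ->
  characteristic_equations b (fun x => f1 x / f x) u v -> v 0%R 0%R = 0 ->
  (forall x, (Rabs x < b)%R -> (Cmod (u x x) <= eps)%R /\ (Cmod (u x (- x)%R) <= eps)%R) ->
  forall sigma y, (sigma * sigma = 1)%R -> (Rabs y < b)%R ->
    (Cmod (riemann_invariant sigma u v y (- sigma * y)%R)
       <= (2 + L * (1 + 2 * F1 * b)) * eps)%R.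
Proof.
  intros HL HF1 Hf Hf0 Hchar Hv0 Hu sigma y Hs Hy.
  set (tau := (- sigma)%R).
  assert (Htau : (tau * tau = 1)%R) by (unfold tau; rewrite <- Hs; ring).
  set (A := riemann_invariant tau u v).
  assert (Hut : forall x, (Rabs x < b)%R -> (Cmod (u x (tau * x)%R) <= eps)%R).
  { intros x Hx. destruct (unit_sign _ Htau) as [->| ->].
    - rewrite Rmult_1_l. apply Hu, Hx.
    - replace (-1 * x)%R with (- x)%R by ring. apply Hu, Hx. }
  assert (Htx : forall x, (Rabs x < b)%R -> (Rabs (tau * x) < b)%R).
  { intros x Hx. rewrite Rabs_mult. destruct (unit_sign _ Htau) as [->| ->];
    [rewrite Rabs_R1|rewrite Rabs_m1]; lra. }
  assert (Hb : (0 < b)%R) by (generalize (Rabs_pos y); lra).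
  assert (Hder : forall x, (Rabs x < b)%R ->
     is_Cderive (fun s => f s * A s (tau * s)%R) x (2 * f1 x * u x (tau * x)%R)).
  { intros x Hx. destruct (Hf x Hx) as [Hfx [Hdf _]].
    replace (2 * f1 x * u x (tau * x)%R) with
      (f1 x * A x (tau * x)%R + f x * (f1 x / f x * riemann_invariant (- tau) u v x (tau * x)%R)).
    2:{ transitivity (f1 x * (A x (tau * x)%R + riemann_invariant (- tau) u v x (tau * x)%R));
          [field; assumption|].
        unfold A. rewrite riemann_invariant_sum. ring. }
    apply (is_Cderive_mult f (fun s => A s (tau * s)%R)); [exact Hdf|].
    apply is_derive_ext with (fun s => A (x + (s - x))%R (tau * x + tau * (s - x))%R).
    { intros s. f_equal; ring. }
    replace (f1 x / f x * riemann_invariant (- tau) u v x (tau * x)%R) with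
      (scal (V := C_R_NormedModule) 1%R (f1 x / f x * riemann_invariant (- tau) u v x (tau * x)%R))
      by apply (scal_one (V := C_R_NormedModule)).
    apply (is_derive_comp (V := C_R_NormedModule)
       (fun s => A (x + s)%R (tau * x + tau * s)%R) (fun s => s - x)%R).
    - rewrite Rminus_diag. apply (Hchar tau x (tau * x)%R); auto.
    - auto_derive; auto; ring. }
  (* The sign theta lets the diagonal be run over nonnegative times up to y. *)
  assert (Htheta : exists theta, (theta * theta = 1 /\ theta * Rabs y = y)%R).
  { destruct (Rle_dec 0 y); [exists 1%R; rewrite Rabs_pos_eq by lra
                                |exists (-1)%R; rewrite Rabs_left by lra]; lra. }
  destruct Htheta as [theta [Hth1 Hth2]].
  assert (Hthabs : Rabs theta = 1%R).
  { destruct (unit_sign _ Hth1) as [->| ->]; [apply Rabs_R1|apply Rabs_m1]. }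
  assert (Heps : (0 <= eps)%R).
  { eapply Rle_trans; [apply Cmod_ge_0|]. apply (Hut y Hy). }
  assert (Hinc := Cmod_increment_le
    (fun s => f (theta * s)%R * A (theta * s)%R (tau * (theta * s))%R)
    (fun s => scal (V := C_R_NormedModule) theta (2 * f1 (theta * s)%R * u (theta * s)%R (tau * (theta * s))%R))
    (fun s => 2 * F1 * eps * s)%R (fun _ => 2 * F1 * eps)%R (Rabs y) (Rabs_pos y)).
  cbv beta in Hinc. rewrite Hth2, !Rmult_0_r in Hinc.
  assert (Hths : forall s, (0 <= s <= Rabs y)%R -> (Rabs (theta * s) < b)%R).
  { intros s Hs0. rewrite Rabs_mult, Hthabs, (Rabs_pos_eq s); lra. }
  assert (Hdiff : (Cmod (f y * A y (tau * y)%R - f 0%R * A 0%R 0%R) <= 2 * F1 * eps * Rabs y - 0)%R).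
  { apply Hinc.
    - intros s Hs0. apply (is_derive_comp (V := C_R_NormedModule)
        (fun s => f s * A s (tau * s)%R) (fun s => theta * s)%R).
      + apply Hder, Hths, Hs0.
      + auto_derive; auto; ring.
    - intros s _. auto_derive; auto; ring.
    - intros s Hs0. rewrite scal_R_Cmult, !Cmod_mult, !Cmod_R, Hthabs, Rmult_1_l.
      rewrite (Rabs_pos_eq 2) by lra.
      specialize (Hths s Hs0). destruct (Hf _ Hths) as [_ [_ [_ B1]]].
      apply Rmult_le_compat; auto; try apply Cmod_ge_0.
      + apply Rmult_le_pos; [lra|apply Cmod_ge_0].
      + lra. }
  assert (H0 : (Cmod (A 0%R 0%R) <= eps)%R).
  { unfold A, riemann_invariant. rewrite Hv0.
    replace (u 0%R 0%R - RtoC tau * 0) with (u 0%R 0%R) by ring.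
    apply Hu. rewrite Rabs_R0. exact Hb. }
  rewrite Hf0 in Hdiff.
  assert (HfA : (Cmod (f y * A y (tau * y)%R) <= eps * (1 + 2 * F1 * b))%R).
  { assert (T := Cmod_triangle (f y * A y (tau * y)%R - 1 * A 0%R 0%R) (A 0%R 0%R)).
    replace (f y * A y (tau * y)%R - 1 * A 0%R 0%R + A 0%R 0%R) with (f y * A y (tau * y)%R) in T by ring.
    assert (2 * F1 * eps * Rabs y <= 2 * F1 * eps * b)%R.
    { apply Rmult_le_compat_l; [apply Rmult_le_pos; lra|lra]. }
    lra. }
  destruct (Hf y Hy) as [Hfy [_ [HLy _]]].
  assert (HA : (Cmod (A y (tau * y)%R) <= L * (eps * (1 + 2 * F1 * b)))%R).
  { replace (A y (tau * y)%R) with (/ f y * (f y * A y (tau * y)%R)) by (field; exact Hfy).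
    rewrite Cmod_mult. apply Rmult_le_compat; auto; apply Cmod_ge_0. }
  assert (HS := riemann_invariant_sum sigma u v y (tau * y)%R). fold tau in HS. fold A in HS.
  replace (riemann_invariant sigma u v y (tau * y)%R) with
    (2 * u y (tau * y)%R + - A y (tau * y)%R) by (rewrite <- HS; ring).
  eapply Rle_trans; [apply Cmod_triangle|].
  rewrite Cmod_opp, Cmod_mult, Cmod_R, (Rabs_pos_eq 2) by lra.
  specialize (Hut y Hy). lra.
Qed.

(** The norm of [u + v j] is the mean of the moduli of its two Riemann invariants,
    so it is enough to bound each of them. *)
Lemma goursat_stability (b L F1 : R) (f f1 : R -> C) :
  (0 < b)%R -> (0 <= L)%R -> (0 <= F1)%R ->
  (forall x, (Rabs x < b)%R -> f x <> 0 /\ is_Cderive f x (f1 x) /\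
     (Cmod (/ f x) <= L)%R /\ (Cmod (f1 x) <= F1)%R) ->
  f 0%R = 1 ->
  exists kappa : R, (0 < kappa)%R /\
    forall (u v : R -> R -> C) (eps : R),
    characteristic_solution b (fun x => f1 x / f x) u v -> v 0%R 0%R = 0 ->
    (forall x, (Rabs x < b)%R -> (Cmod (u x x) <= eps)%R /\ (Cmod (u x (- x)%R) <= eps)%R) ->
    forall p, square b p -> (Bnorm (u (fst p) (snd p), v (fst p) (snd p)) <= kappa * eps)%R.
Proof.
  intros Hb HL HF1 Hf Hf0.
  set (G := (F1 * L + 1)%R). set (K1 := (2 + L * (1 + 2 * F1 * b))%R).
  exists (2 * K1 * exp (2 * G * b))%R. split.
  { apply Rmult_lt_0_compat; [|apply exp_pos]. unfold K1.
    assert (0 <= L * (1 + 2 * F1 * b))%R.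
    { apply Rmult_le_pos; auto. generalize (Rmult_le_pos F1 b HF1). lra. } lra. }
  intros u v eps [Hchar [[Hbu Hcu] [Hbv Hcv]]] Hv0 Hu.
  assert (HG : (0 < G)%R).
  { unfold G. generalize (Rmult_le_pos _ _ HF1 HL). lra. }
  assert (Hopen : forall sigma x t, (sigma * sigma = 1)%R -> (Rabs x < b)%R -> (Rabs t < b)%R ->
     (Cmod (riemann_invariant sigma u v x t) <= 2 * (K1 * eps) * exp (2 * G * b))%R).
  { intros sigma x t Hs Hx Ht.
    apply (goursat_estimate b G (K1 * eps) (fun x => f1 x / f x) (fun sigma => riemann_invariant sigma u v)); auto.
    - intros y Hy. destruct (Hf y Hy) as [_ [_ [B1 B2]]].
      unfold Cdiv. rewrite Cmod_mult. unfold G.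
      assert (Cmod (f1 y) * Cmod (/ f y) <= F1 * L)%R
        by (apply Rmult_le_compat; auto; apply Cmod_ge_0). lra.
    - intros r Hr. destruct (Hbu r Hr) as [M1 HM1]. destruct (Hbv r Hr) as [M2 HM2].
      exists (M1 + M2)%R. intros s y z Hs' Hy Hz. unfold riemann_invariant, Cminus.
      eapply Rle_trans; [apply Cmod_triangle|].
      rewrite Cmod_opp, Cmod_mult, Cmod_R.
      replace (Rabs s) with 1%R.
      2:{ destruct (unit_sign _ Hs') as [->| ->]; [rewrite Rabs_R1|rewrite Rabs_m1]; auto. }
      specialize (HM1 y z Hy Hz). specialize (HM2 y z Hy Hz). lra.
    - intros s y Hs' Hy. apply (diagonal_estimate b L F1 eps f f1 u v); auto. }
  assert (Hcont : forall sigma x t, square b (x, t) ->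
    filterlim (fun s => riemann_invariant sigma u v s t) (within (segment b) (locally x))
      (locally (T := C_R_NormedModule) (riemann_invariant sigma u v x t)) /\
    filterlim (fun s => riemann_invariant sigma u v x s) (within (segment b) (locally t))
      (locally (T := C_R_NormedModule) (riemann_invariant sigma u v x t))).
  { intros sigma x t Hxt. destruct (Hcu x t Hxt) as [U1 U2]. destruct (Hcv x t Hxt) as [V1 V2].
    assert (Hlin : forall w1 w2 : C, w1 - RtoC sigma * w2 = w1 + RtoC (- sigma) * w2)
      by (intros; rewrite RtoC_opp; ring).
    unfold riemann_invariant. rewrite Hlin.
    split; eapply filterlim_ext; try (intros; symmetry; apply Hlin);
      (apply filterlim_Cplus; [apply within_filter, locally_filter|assumption|]);
      (apply filterlim_Cmult; [apply within_filter, locally_filter|apply filterlim_const|assumption]). }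
  assert (Hclosed : forall sigma x t, (sigma * sigma = 1)%R -> square b (x, t) ->
     (Cmod (riemann_invariant sigma u v x t) <= 2 * (K1 * eps) * exp (2 * G * b))%R).
  { intros sigma x t Hs [Hx Ht]. simpl in Hx, Ht.
    apply (Cmod_le_closed_segment b _ x (fun x => riemann_invariant sigma u v x t)); auto.
    { apply Hcont; split; assumption. }
    intros y Hy.
    apply (Cmod_le_closed_segment b _ t (fun t => riemann_invariant sigma u v y t)); auto.
    apply Hcont; split; [apply Rabs_lt_segment|]; assumption. }
  intros [x t] Hp. simpl.
  assert (H1 := Hclosed (-1)%R x t ltac:(ring) Hp).
  assert (H2 := Hclosed 1%R x t ltac:(ring) Hp).
  unfold Bnorm. cbn [fst snd].
  unfold riemann_invariant in H1, H2.
  replace (u x t - RtoC (-1) * v x t) with (u x t + v x t) in H1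
    by (replace (-1)%R with (Ropp 1) by ring; rewrite RtoC_opp; ring).
  replace (u x t - RtoC 1 * v x t) with (u x t - v x t) in H2 by ring.
  lra.
Qed.

(** * Iterated integrals *)

Lemma RInt_0_Cderive (h : R -> C) (x : R) :
  (forall y, Ccontinuous h y) ->
  is_Cderive (fun y => RInt (V := C_R_CompleteNormedModule) h 0 y) x (h x).
Proof.
  intros Hh. apply (is_derive_RInt (V := C_R_NormedModule) h _ 0 x); [|apply Hh].
  apply filter_forall. intros y.
  apply (RInt_correct (V := C_R_CompleteNormedModule)).
  apply (ex_RInt_continuous (V := C_R_CompleteNormedModule)). intros z _; apply Hh.
Qed.

Lemma alt_pow_even (w : C) (n : nat) : Nat.even n = true -> alt_pow w n = w.
Proof. unfold alt_pow. intros ->. reflexivity. Qed.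

Lemma alt_pow_odd (w : C) (n : nat) : Nat.even n = false -> alt_pow w n = / w.
Proof. unfold alt_pow. intros ->. reflexivity. Qed.

Lemma alt_pow_continuous (f : R -> C) (n : nat) (x : R) :
  f x <> 0 -> Ccontinuous f x -> Ccontinuous (fun s => alt_pow (f s * f s) n) x.
Proof.
  intros Hnz Hf. unfold alt_pow. destruct (Nat.even n).
  - apply Ccontinuous_mult; auto.
  - apply filterlim_Cinv; [apply locally_filter|apply Cmult_neq_0; auto|].
    apply filterlim_Cmult; auto; apply locally_filter.
Qed.

(** Both families of iterated integrals are built by this step. *)
Lemma weighted_integral_Cderive (f h : R -> C) (m n : nat) (x : R) :
  (forall y, f y <> 0) -> (forall y, Ccontinuous f y) -> (forall y, Ccontinuous h y) ->
  is_Cderive (fun y => RtoC (INR m) * RInt (V := C_R_CompleteNormedModule)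
      (fun s => h s * alt_pow (f s * f s) n) 0 y) x
    (RtoC (INR m) * (h x * alt_pow (f x * f x) n)).
Proof.
  intros Hnz Hf Hh.
  set (J := fun y => RInt (V := C_R_CompleteNormedModule) (fun s => h s * alt_pow (f s * f s) n) 0 y).
  replace (RtoC (INR m) * (h x * alt_pow (f x * f x) n))
    with (0 * J x + RtoC (INR m) * (h x * alt_pow (f x * f x) n)) by ring.
  apply (is_Cderive_mult (fun _ => RtoC (INR m)) J).
  - apply (is_derive_const (V := C_R_NormedModule)).
  - apply (RInt_0_Cderive (fun s => h s * alt_pow (f s * f s) n)).
    intros y. apply Ccontinuous_mult; auto using alt_pow_continuous.
Qed.

Lemma X_pow_continuous (f : R -> C) (n : nat) :
  (forall y, f y <> 0) -> (forall y, Ccontinuous f y) -> forall x, Ccontinuous (X_pow f n) x.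
Proof.
  intros Hnz Hf. induction n as [|n IH]; intros x.
  - apply (continuous_const (U := R_UniformSpace) (V := C_R_NormedModule)).
  - eapply is_Cderive_continuous, weighted_integral_Cderive; assumption.
Qed.

Lemma Xtilde_pow_continuous (f : R -> C) (n : nat) :
  (forall y, f y <> 0) -> (forall y, Ccontinuous f y) -> forall x, Ccontinuous (Xtilde_pow f n) x.
Proof.
  intros Hnz Hf. induction n as [|n IH]; intros x.
  - apply (continuous_const (U := R_UniformSpace) (V := C_R_NormedModule)).
  - eapply is_Cderive_continuous, weighted_integral_Cderive; assumption.
Qed.

Lemma phi_continuous (f : R -> C) (n : nat) :
  (forall y, f y <> 0) -> (forall y, Ccontinuous f y) -> forall x, Ccontinuous (phi f n) x.
Proof.
  intros Hnz Hf x. unfold phi. destruct (Nat.odd n); apply Ccontinuous_mult;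
  auto using X_pow_continuous, Xtilde_pow_continuous.
Qed.

Lemma psi_continuous (f : R -> C) (n : nat) :
  (forall y, f y <> 0) -> (forall y, Ccontinuous f y) -> forall x, Ccontinuous (psi f n) x.
Proof.
  intros Hnz Hf x.
  assert (Hi : Ccontinuous (fun s => / f s) x) by (apply filterlim_Cinv; [apply locally_filter|apply Hnz|apply Hf]).
  unfold psi. destruct (Nat.odd n); apply (Ccontinuous_mult _ (fun s => / f s));
  auto using X_pow_continuous, Xtilde_pow_continuous.
Qed.

(** Dividing by [f] leaves an iterated integral, whose derivative is [k] times the
    previous one over [f^2]; the parity conventions make that quotient
    [k psi_(k-1) / f]. For [k = 0] the truncated index [k - 1] is multiplied by [0]. *)
Lemma phi_Cderive (f : R -> C) (df : C) (k : nat) (x : R) :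
  (forall y, f y <> 0) -> (forall y, Ccontinuous f y) -> is_Cderive f x df ->
  is_Cderive (phi f k) x (df / f x * phi f k x + RtoC (INR k) * psi f (k - 1) x).
Proof.
  intros Hnz Hf Hd. destruct k as [|k].
  - unfold phi; simpl. apply is_derive_ext with f; [intros; simpl; as_C; ring|].
    evar_last; [exact Hd|]. as_C. field. apply Hnz.
  - replace (S k - 1)%nat with k by lia. unfold phi, psi. rewrite Nat.odd_succ.
    rewrite <- Nat.negb_even. destruct (Nat.even k) eqn:Hk; simpl negb; cbv iota.
    + evar_last; [apply (is_Cderive_mult f (X_pow f (S k))); [exact Hd|];
        apply (weighted_integral_Cderive f (X_pow f k) (S k) (S k)); auto using X_pow_continuous|].
      rewrite alt_pow_odd by (rewrite Nat.even_succ, <- Nat.negb_even, Hk; reflexivity).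
      field. apply Hnz.
    + evar_last; [apply (is_Cderive_mult f (Xtilde_pow f (S k))); [exact Hd|];
        apply (weighted_integral_Cderive f (Xtilde_pow f k) (S k) (S k - 1)); auto using Xtilde_pow_continuous|].
      replace (S k - 1)%nat with k by lia. rewrite alt_pow_odd by exact Hk.
      field. apply Hnz.
Qed.

(** As for [phi_Cderive], with the product by [f] in place of the quotient. *)
Lemma psi_Cderive (f : R -> C) (df : C) (k : nat) (x : R) :
  (forall y, f y <> 0) -> (forall y, Ccontinuous f y) -> is_Cderive f x df ->
  is_Cderive (psi f k) x (- (df / f x * psi f k x) + RtoC (INR k) * phi f (k - 1) x).
Proof.
  intros Hnz Hf Hd. assert (Hi := is_Cderive_inv f x df (Hnz x) Hd). destruct k as [|k].
  - unfold psi; simpl. apply is_derive_ext with (fun s => / f s); [intros; simpl; as_C; unfold Cdiv; ring|].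
    evar_last; [exact Hi|]. as_C. field. apply Hnz.
  - replace (S k - 1)%nat with k by lia. unfold phi, psi. rewrite Nat.odd_succ.
    rewrite <- Nat.negb_even. destruct (Nat.even k) eqn:Hk; simpl negb; cbv iota.
    + evar_last; [apply (is_Cderive_mult (Xtilde_pow f (S k)) (fun s => / f s)); [|exact Hi];
        apply (weighted_integral_Cderive f (Xtilde_pow f k) (S k) (S k - 1)); auto using Xtilde_pow_continuous|].
      replace (S k - 1)%nat with k by lia. rewrite alt_pow_even by exact Hk.
      field. apply Hnz.
    + evar_last; [apply (is_Cderive_mult (X_pow f (S k)) (fun s => / f s)); [|exact Hi];
        apply (weighted_integral_Cderive f (X_pow f k) (S k) (S k)); auto using X_pow_continuous|].
      rewrite alt_pow_even by (rewrite Nat.even_succ, <- Nat.negb_even, Hk; reflexivity).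
      field. apply Hnz.
Qed.

(** The integration interval from [0] to [x] lies in the segment. *)
Lemma X_pow_ext (b : R) (f g : R -> C) (n : nat) (x : R) :
  (forall y, segment b y -> f y = g y) -> segment b x -> X_pow f n x = X_pow g n x.
Proof.
  intros Hfg. revert x. induction n as [|n IH]; intros x Hx; [reflexivity|].
  cbn [X_pow]. f_equal. apply (RInt_ext (V := C_R_CompleteNormedModule)). intros s Hs.
  assert (Hsb : segment b s).
  { destruct Hx as [Hx1 Hx2]. unfold segment. unfold Rmin, Rmax in Hs.
    destruct (Rle_dec 0 x); lra. }
  rewrite IH, Hfg by exact Hsb. reflexivity.
Qed.

Lemma Xtilde_pow_ext (b : R) (f g : R -> C) (n : nat) (x : R) :
  (forall y, segment b y -> f y = g y) -> segment b x -> Xtilde_pow f n x = Xtilde_pow g n x.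
Proof.
  intros Hfg. revert x. induction n as [|n IH]; intros x Hx; [reflexivity|].
  cbn [Xtilde_pow]. f_equal. apply (RInt_ext (V := C_R_CompleteNormedModule)). intros s Hs.
  assert (Hsb : segment b s).
  { destruct Hx as [Hx1 Hx2]. unfold segment. unfold Rmin, Rmax in Hs.
    destruct (Rle_dec 0 x); lra. }
  rewrite IH, Hfg by exact Hsb. reflexivity.
Qed.

Lemma X_pow_S_0 (f : R -> C) (k : nat) : X_pow f (S k) 0 = 0.
Proof.
  cbn [X_pow]. rewrite (RInt_point (V := C_R_CompleteNormedModule)).
  apply Cmult_0_r.
Qed.

Lemma Xtilde_pow_S_0 (f : R -> C) (k : nat) : Xtilde_pow f (S k) 0 = 0.
Proof.
  cbn [Xtilde_pow]. rewrite (RInt_point (V := C_R_CompleteNormedModule)).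
  apply Cmult_0_r.
Qed.

(** * Wave polynomials and formal powers as binomial sums *)

Notation Csum := (sum_n (G := C_AbelianMonoid)).

Notation Csum_n_m := (sum_n_m (G := C_AbelianMonoid)).

Lemma Csum_O (a : nat -> C) : Csum a 0 = a 0%nat.
Proof. exact (sum_O (G := C_AbelianMonoid) a). Qed.

Lemma Csum_S (a : nat -> C) (n : nat) : Csum a (S n) = Csum a n + a (S n).
Proof. exact (sum_Sn (G := C_AbelianMonoid) a n). Qed.

Lemma Csum_n_m_1_0 (a : nat -> C) : Csum_n_m a 1 0 = RtoC 0.
Proof. apply (sum_n_m_zero (G := C_AbelianMonoid)). lia. Qed.

Lemma Csum_n_m_1_S (a : nat -> C) (N : nat) : Csum_n_m a 1 (S N) = Csum_n_m a 1 N + a (S N).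
Proof. apply (sum_n_Sm (G := C_AbelianMonoid) a 1 N). lia. Qed.

Lemma is_Cderive_sum (h : nat -> R -> C) (d : nat -> C) (x : R) (n : nat) :
  (forall k, (k <= n)%nat -> is_Cderive (h k) x (d k)) ->
  is_Cderive (fun s => Csum (fun k => h k s) n) x (Csum d n).
Proof.
  intros H. exact (is_derive_sum_n (V := C_R_NormedModule) h n x d H).
Qed.

Lemma tame_sum (b : R) (w : nat -> R -> R -> C) (N : nat) :
  (forall k, tame b (w k)) ->
  tame b (fun x t => sum_n (G := C_AbelianMonoid) (fun k => w k x t) N).
Proof.
  intros H. induction N as [|N IH].
  - apply tame_ext with (2 := H O). intros; rewrite sum_O; reflexivity.
  - apply tame_ext with (2 := tame_plus _ _ _ IH (H (S N))).
    intros; rewrite sum_Sn; reflexivity.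
Qed.

(** The coefficient of [t ^ k] in a formal power alternates between the two
    components of [a], because even and odd powers of [t] belong to different wave
    polynomials. *)
Definition alternate (a a' : C) (k : nat) : C := if Nat.even k then a else a'.

Lemma alternate_S (a a' : C) (k : nat) : alternate a a' (S k) = alternate a' a k.
Proof.
  unfold alternate. rewrite Nat.even_succ, <- Nat.negb_even. destruct (Nat.even k); reflexivity.
Qed.

Definition binomial_sum (g : nat -> R -> C) (alpha : nat -> C) (n : nat) (x t : R) : C :=
  Csum (fun k => RtoC (Binomial.C n k) * g (n - k)%nat x * RtoC (t ^ k) * alpha k) n.

Lemma wave_poly_odd_index (g : nat -> R -> C) (m : nat) (x t : R) :
  wave_poly g (2 * S m - 1) x t = even_sum g (S m) x t.
Proof.
  replace (2 * S m - 1)%nat with (S (2 * m)) by lia. unfold wave_poly.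
  rewrite Nat.odd_succ, Nat.even_mul. simpl orb. cbv iota.
  replace (S (S (2 * m))) with (2 * S m)%nat by lia. rewrite Nat.div2_double. reflexivity.
Qed.

Lemma wave_poly_even_index (g : nat -> R -> C) (m : nat) (x t : R) :
  wave_poly g (2 * S m) x t = odd_sum g (S m) x t.
Proof.
  unfold wave_poly. rewrite Nat.odd_mul. simpl andb. cbv iota. rewrite Nat.div2_double.
  destruct (2 * S m)%nat eqn:E; [lia|reflexivity].
Qed.

Lemma odd_sum_from_0 (g : nat -> R -> C) (m : nat) (x t : R) :
  odd_sum g m x t = Csum (fun k => if Nat.odd k
              then RtoC (Binomial.C m k) * g (m - k)%nat x * RtoC (t ^ k) else RtoC 0) m.
Proof.
  unfold odd_sum, sum_n. rewrite (sum_Sn_m _ 0 m) by lia. simpl Nat.odd. cbv iota.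
  symmetry. apply (plus_zero_l (G := C_AbelianMonoid)).
Qed.

Lemma even_sum_opp (g : nat -> R -> C) (m : nat) (x t : R) :
  even_sum g m x (- t) = even_sum g m x t.
Proof.
  unfold even_sum. apply (sum_n_m_ext (G := C_AbelianMonoid)). intros k.
  destruct (Nat.even k) eqn:E; [|reflexivity]. apply Nat.even_spec in E. destruct E as [j ->].
  rewrite !pow_mult. do 2 f_equal. f_equal. ring.
Qed.

Lemma odd_sum_opp (g : nat -> R -> C) (m : nat) (x t : R) :
  odd_sum g m x (- t) = - odd_sum g m x t.
Proof.
  rewrite !odd_sum_from_0. generalize m at 3 6. intros N.
  assert (H : forall k, (if Nat.odd k then RtoC (Binomial.C m k) * g (m - k)%nat x * RtoC ((- t) ^ k) else RtoC 0)
    = - (if Nat.odd k then RtoC (Binomial.C m k) * g (m - k)%nat x * RtoC (t ^ k) else RtoC 0)).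
  { intros k. destruct (Nat.odd k) eqn:E; [|ring]. apply Nat.odd_spec in E. destruct E as [j ->].
    rewrite !pow_add, !pow_mult, !pow_1. replace ((- t) ^ 2)%R with (t ^ 2)%R by ring.
    rewrite !RtoC_mult, RtoC_opp. ring. }
  induction N as [|N IH].
  - rewrite !Csum_O. apply H.
  - rewrite !Csum_S, IH, H.
    assert (Hr : forall p q : C, - p + - q = - (p + q)) by (intros; ring). apply Hr.
Qed.

Lemma even_odd_sum (g : nat -> R -> C) (a a' : C) (m : nat) (x t : R) :
  a * even_sum g m x t + a' * odd_sum g m x t = binomial_sum g (alternate a a') m x t.
Proof.
  rewrite odd_sum_from_0. unfold even_sum, binomial_sum. fold (Csum (fun k => if Nat.even k
              then RtoC (Binomial.C m k) * g (m - k)%nat x * RtoC (t ^ k) else RtoC 0) m).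
  generalize m at 3 6 9. intros N.
  assert (H : forall k c, a * (if Nat.even k then c else 0) + a' * (if Nat.odd k then c else 0)
     = c * alternate a a' k).
  { intros k c. unfold alternate. rewrite <- Nat.negb_even. destruct (Nat.even k); simpl; ring. }
  induction N as [|N IH].
  - rewrite !Csum_O. apply H.
  - rewrite !Csum_S, <- IH, <- H.
    assert (Hr : forall e o e' o' : C,
      a * (e + e') + a' * (o + o') = a * e + a' * o + (a * e' + a' * o')) by (intros; ring).
    apply Hr.
Qed.

Lemma binomial_C_0_0 : Binomial.C 0 0 = 1%R.
Proof. unfold Binomial.C. simpl. field. Qed.

(** Gathers the even and the odd wave polynomials of the same order; the case
    [n = 0] is no longer exceptional. *)
Lemma formal_power_binomial (f : R -> C) (n : nat) (a a' : C) (x t : R) :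
  formal_power f n (a, a') x t =
  (binomial_sum (phi f) (alternate a a') n x t, binomial_sum (psi f) (alternate a' a) n x t).
Proof.
  destruct n as [|n].
  - unfold binomial_sum, formal_power, wave_u, wave_v, wave_poly. rewrite !Csum_O, binomial_C_0_0.
    unfold alternate. simpl. f_equal; ring.
  - unfold formal_power, wave_u, wave_v.
    rewrite !wave_poly_odd_index, !wave_poly_even_index, <- !even_odd_sum.
    apply f_equal2; ring.
Qed.

Lemma formal_power_ext (b : R) (f g : R -> C) (n : nat) (a : bicomplex) (x t : R) :
  (forall y, segment b y -> f y = g y) -> segment b x ->
  formal_power f n a x t = formal_power g n a x t.
Proof.
  intros Hfg Hx. destruct a as [a a']. rewrite !formal_power_binomial. unfold binomial_sum.
  apply f_equal2; apply (sum_n_ext (G := C_AbelianMonoid)); intros k; unfold phi, psi;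
  rewrite (X_pow_ext b f g), (Xtilde_pow_ext b f g), Hfg by auto; reflexivity.
Qed.

(** Only the term [k = n], which carries [g 0], survives. *)
Lemma binomial_sum_at_0 (g : nat -> R -> C) (alpha : nat -> C) (n : nat) (t : R) :
  g 0%nat 0%R = 1 -> (forall k, g (S k) 0%R = 0) ->
  binomial_sum g alpha n 0 t = alpha n * RtoC (t ^ n).
Proof.
  intros H0 HS. unfold binomial_sum.
  assert (Hz : forall N, (N < n)%nat ->
    Csum (fun k => RtoC (Binomial.C n k) * g (n - k)%nat 0%R * RtoC (t ^ k) * alpha k) N = RtoC 0).
  { induction N as [|N IH]; intros HN.
    - rewrite Csum_O. destruct n as [|n]; [lia|]. rewrite Nat.sub_0_r, HS. as_C; ring.
    - rewrite Csum_S, IH by lia. destruct (n - S N)%nat eqn:E; [lia|].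
      rewrite HS. as_C; ring. }
  assert (Hnn : Binomial.C n n = 1%R).
  { unfold Binomial.C. rewrite Nat.sub_diag. simpl. field. apply INR_fact_neq_0. }
  destruct n as [|n].
  - rewrite Csum_O. rewrite Hnn, Nat.sub_diag, H0. as_C; ring.
  - rewrite Csum_S, Hz by lia. rewrite Hnn, Nat.sub_diag, H0. as_C; ring.
Qed.

Lemma formal_power_at_0 (f : R -> C) (n : nat) (a a' : C) (t : R) :
  f 0%R = 1 ->
  formal_power f n (a, a') 0 t =
  (alternate a a' n * RtoC (t ^ n), alternate a' a n * RtoC (t ^ n)).
Proof.
  intros Hf. rewrite formal_power_binomial.
  rewrite !binomial_sum_at_0; [reflexivity|..].
  - unfold psi; simpl. rewrite Hf. field. 
  - intros k. unfold psi. destruct (Nat.odd (S k)); rewrite ?X_pow_S_0, ?Xtilde_pow_S_0; unfold Cdiv; ring.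
  - unfold phi; simpl. rewrite Hf. ring.
  - intros k. unfold phi. destruct (Nat.odd (S k)); rewrite ?X_pow_S_0, ?Xtilde_pow_S_0; ring.
Qed.

(** * Formal powers solve the characteristic system *)

(** Makes differentiation in [t] of one term of a binomial sum match
    differentiation in [x] of the preceding one. *)
Lemma binomial_C_absorption (n k : nat) : (k < n)%nat ->
  (Binomial.C n (S k) * INR (S k) = Binomial.C n k * INR (n - k))%R.
Proof.
  intros H. unfold Binomial.C. replace (n - k)%nat with (S (n - S k)) by lia.
  rewrite !fact_simpl, !mult_INR.
  assert (N := INR_fact_neq_0). field. repeat split; auto using not_0_INR.
Qed.

(** [P] and [Q] stand for the values at [x] of [phi] and [psi]; the left-hand side
    is then the derivative along [(1, sigma)] of a Riemann invariant of a formal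
    power, summed up to the index [N]. The part of the [k]-th term coming from the index
    shift in [x] cancels the part of the next term coming from [t ^ (k + 1)], and the
    last summand is what is left over. It vanishes for [N = n]. *)
Lemma binomial_sum_telescope (n : nat) (P Q alpha beta : nat -> C) (g : C) (sigma t : R) :
  (sigma * sigma = 1)%R ->
  (forall k, alpha (S k) = beta k) -> (forall k, beta (S k) = alpha k) ->
  forall N, (N <= n)%nat ->
  Csum (fun k => RtoC (Binomial.C n k) *
     (RtoC (INR k * sigma * t ^ Nat.pred k) * (alpha k * P (n - k)%nat - RtoC sigma * beta k * Q (n - k)%nat)
      + RtoC (t ^ k) *
        (alpha k * (g * P (n - k)%nat + RtoC (INR (n - k)) * Q (n - k - 1)%nat)
         - RtoC sigma * beta k * (- (g * Q (n - k)%nat) + RtoC (INR (n - k)) * P (n - k - 1)%nat)))) N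
  = g * Csum (fun k => RtoC (Binomial.C n k) * (RtoC (t ^ k) *
         (alpha k * P (n - k)%nat + RtoC sigma * beta k * Q (n - k)%nat))) N
    + RtoC (Binomial.C n N * INR (n - N)) * (RtoC (t ^ N) *
        (alpha N * Q (n - N - 1)%nat - RtoC sigma * beta N * P (n - N - 1)%nat)).
Proof.
  intros Hs Ha Hb N.
  assert (Hs' : RtoC sigma * RtoC sigma = 1) by (rewrite <- RtoC_mult, Hs; reflexivity).
  induction N as [|N IH]; intros HN.
  - rewrite !Csum_O. rewrite Nat.sub_0_r. rewrite !Rmult_0_l, RtoC_mult. simpl pow. as_C. ring.
  - rewrite !Csum_S, IH by lia. rewrite Ha, Hb.
    replace (n - N - 1)%nat with (n - S N)%nat by lia.
    rewrite <- binomial_C_absorption by lia.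
    simpl Nat.pred. rewrite !RtoC_mult.
    set (u := RtoC (Binomial.C n (S N))). set (w := RtoC (INR (S N))).
    set (s := RtoC sigma) in *.
    replace (beta N * P (n - S N)%nat - s * alpha N * Q (n - S N)%nat) with
       (s * (s * (beta N * P (n - S N)%nat)) - s * alpha N * Q (n - S N)%nat)
      by (transitivity (s * s * (beta N * P (n - S N)%nat) - s * alpha N * Q (n - S N)%nat);
          [as_C; ring|as_C; rewrite Hs'; ring]).
    replace (w * s * RtoC (t ^ N) * (s * (s * (beta N * P (n - S N)%nat)) - s * alpha N * Q (n - S N)%nat))
      with (w * RtoC (t ^ N) * (s * s) * (s * (beta N * P (n - S N)%nat) - alpha N * Q (n - S N)%nat)) by (as_C; ring).
    rewrite Hs'. as_C. ring.
Qed.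

Lemma riemann_invariant_binomial (sigma : R) (P Q : nat -> R -> C) (alpha beta : nat -> C) (n : nat) (x t : R) :
  riemann_invariant sigma (binomial_sum P alpha n) (binomial_sum Q beta n) x t =
  Csum (fun k => RtoC (Binomial.C n k) * (RtoC (t ^ k) *
     (alpha k * P (n - k)%nat x + - RtoC sigma * beta k * Q (n - k)%nat x))) n.
Proof.
  unfold riemann_invariant, binomial_sum. generalize n at 3 6 10. intros N.
  induction N as [|N IH].
  - rewrite !Csum_O. as_C. ring.
  - rewrite !Csum_S, <- IH. as_C. ring.
Qed.

(** Along a line of slope [sigma] each term of the binomial sum is a product of
    functions of one variable, and the derivatives telescope. Here [f] is continuous
    and nonzero on the whole line, so that the iterated integrals are differentiable
    everywhere. *)
Lemma formal_power_characteristic_solution (b : R) (f f1 : R -> C) (n : nat) (a : bicomplex) :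
  (forall x, f x <> 0) -> (forall x, Ccontinuous f x) ->
  (forall x, (Rabs x < b)%R -> is_Cderive f x (f1 x)) ->
  characteristic_solution b (fun x => f1 x / f x)
    (fun x t => fst (formal_power f n a x t)) (fun x t => snd (formal_power f n a x t)).
Proof.
  intros Hnz Hc Hd. destruct a as [a a'].
  apply characteristic_solution_ext with (binomial_sum (phi f) (alternate a a') n)
    (binomial_sum (psi f) (alternate a' a) n);
    try (intros x t; rewrite formal_power_binomial; reflexivity).
  assert (Htame : forall g alpha, (forall k x, Ccontinuous (g k) x) -> tame b (binomial_sum g alpha n)).
  { intros g alpha Hg. apply tame_sum. intros k.
    apply tame_mult; [apply tame_mult; [apply tame_mult|]|]; try apply tame_const.
    - apply tame_of_x. apply Hg.
    - apply (tame_of_t b (fun t => RtoC (t ^ k))). intros t.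
      apply filterlim_RtoC; [apply locally_filter|].
      apply (ex_derive_continuous (V := R_NormedModule)). auto_derive; auto. }
  split; [|split; apply Htame; intros; [apply phi_continuous|apply psi_continuous]; auto].
  intros sigma x t Hs Hx Ht.
  set (g := f1 x / f x). set (alpha := alternate a a'). set (beta := alternate a' a).
  apply is_derive_ext with (fun s => Csum (fun k => RtoC (Binomial.C n k) * (RtoC ((t + sigma * s) ^ k) *
     (alpha k * phi f (n - k)%nat (x + s)%R + - RtoC sigma * beta k * psi f (n - k)%nat (x + s)%R))) n).
  { intros s. symmetry. apply riemann_invariant_binomial. }
  rewrite riemann_invariant_binomial. fold alpha beta.
  evar_last.
  - apply (is_Cderive_sum (fun k s => RtoC (Binomial.C n k) * (RtoC ((t + sigma * s) ^ k) *
     (alpha k * phi f (n - k)%nat (x + s)%R + - RtoC sigma * beta k * psi f (n - k)%nat (x + s)%R)))).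
    intros k Hk. apply is_Cderive_const_mult.
    apply (is_Cderive_mult (fun s => RtoC ((t + sigma * s) ^ k))).
    + apply is_Cderive_RtoC. instantiate (1 := (INR k * sigma * (t + sigma * 0) ^ Nat.pred k)%R).
      auto_derive; auto. ring.
    + apply is_Cderive_plus; apply is_Cderive_const_mult; apply is_Cderive_shift.
      * apply phi_Cderive; auto.
      * apply psi_Cderive; auto.
  - cbv beta. rewrite Rmult_0_r, !Rplus_0_r. fold g.
    assert (T := binomial_sum_telescope n (fun k => phi f k x) (fun k => psi f k x) alpha beta g sigma t
      Hs (alternate_S a a') (alternate_S a' a) n (Nat.le_refl n)).
    replace (RtoC (Binomial.C n n * INR (n - n))) with (RtoC 0) in T
      by (rewrite Nat.sub_diag, Rmult_0_r; reflexivity).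
    cbv beta in T.
    match type of T with _ = ?r => transitivity r end.
    + etransitivity; [|exact T]. apply (sum_n_ext (G := C_AbelianMonoid)). intros k. as_C.
      ring.
    + rewrite Cmult_0_l, Cplus_0_r. f_equal. apply (sum_n_ext (G := C_AbelianMonoid)). intros k. as_C.
      rewrite RtoC_opp. ring.
Qed.

Definition partial_sum (f : R -> C) (a : nat -> bicomplex) (N : nat) (x t : R) : bicomplex :=
  sum_n (G := B_NormedModule) (fun n => formal_power f n (a n) x t) N.

Lemma partial_sum_components (f : R -> C) (a : nat -> bicomplex) (N : nat) (x t : R) :
  partial_sum f a N x t =
  (Csum (fun n => fst (formal_power f n (a n) x t)) N,
   Csum (fun n => snd (formal_power f n (a n) x t)) N).
Proof.
  unfold partial_sum. induction N as [|N IH].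
  - rewrite sum_O, !Csum_O. apply surjective_pairing.
  - rewrite sum_Sn, IH, !Csum_S. destruct (formal_power f (S N) (a (S N)) x t). reflexivity.
Qed.

Lemma partial_sum_ext (b : R) (f g : R -> C) (a : nat -> bicomplex) (N : nat) (x t : R) :
  (forall y, segment b y -> f y = g y) -> segment b x ->
  partial_sum f a N x t = partial_sum g a N x t.
Proof.
  intros Hfg Hx. apply (sum_n_ext (G := B_NormedModule)). intros n.
  apply (formal_power_ext b); assumption.
Qed.

Lemma characteristic_solution_partial_sum (b : R) (f f1 : R -> C) (a : nat -> bicomplex) (N : nat) :
  (forall x, f x <> 0) -> (forall x, Ccontinuous f x) ->
  (forall x, (Rabs x < b)%R -> is_Cderive f x (f1 x)) ->
  characteristic_solution b (fun x => f1 x / f x)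
    (fun x t => fst (partial_sum f a N x t)) (fun x t => snd (partial_sum f a N x t)).
Proof.
  intros Hnz Hc Hd.
  assert (H := fun n => formal_power_characteristic_solution b f f1 n (a n) Hnz Hc Hd).
  induction N as [|N IH].
  - eapply characteristic_solution_ext; [| |apply (H 0%nat)]; intros x t; cbv beta;
    rewrite partial_sum_components, !Csum_O; reflexivity.
  - eapply characteristic_solution_ext;
      [| |apply (characteristic_solution_combination _ _ 1 _ _ _ _ IH (H (S N)))];
    intros x t; rewrite !partial_sum_components; cbn [fst snd]; rewrite !Csum_S; ring.
Qed.

(** * Expansions on the square and on the diagonals *)

Definition even_trace (f : R -> C) (c : nat -> C) (N : nat) (x : R) : C :=
  c 0%nat * wave_u f 0 x x + Csum_n_m (fun n => c n * wave_u f (2 * n - 1) x x) 1 N.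

Definition odd_trace (f : R -> C) (d : nat -> C) (N : nat) (x : R) : C :=
  Csum_n_m (fun n => d n * wave_u f (2 * n) x x) 1 N.

(** The odd wave polynomials change sign with [t], the even ones do not. *)
Lemma partial_sum_diagonals (f : R -> C) (a : nat -> bicomplex) (N : nat) (x : R) :
  let c := fun n => fst (a n) in let d := fun n => snd (a n) in
  fst (partial_sum f a N x x) = even_trace f c N x + odd_trace f d N x /\
  fst (partial_sum f a N x (- x)) = even_trace f c N x - odd_trace f d N x.
Proof.
  intros c d. rewrite !partial_sum_components. cbn [fst]. unfold even_trace, odd_trace.
  induction N as [|N [IH1 IH2]].
  - rewrite !Csum_O, !Csum_n_m_1_0. unfold formal_power, c. destruct (a 0%nat) as [p q].
    cbn [fst snd]. unfold wave_u, wave_poly. split; ring.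
  - rewrite !Csum_S, IH1, IH2, !Csum_n_m_1_S. unfold formal_power, wave_u.
    change (c (S N)) with (fst (a (S N))). change (d (S N)) with (snd (a (S N))).
    destruct (a (S N)) as [p q]. cbn [fst snd].
    rewrite !wave_poly_odd_index, !wave_poly_even_index, even_sum_opp, odd_sum_opp.
    split; ring.
Qed.

(** All formal powers of positive degree vanish at the origin. *)
Lemma partial_sum_at_origin (f : R -> C) (a : nat -> bicomplex) (N : nat) :
  f 0%R = 1 -> snd (partial_sum f a N 0 0) = snd (a 0%nat).
Proof.
  intros Hf. rewrite partial_sum_components. cbn [snd]. induction N as [|N IH].
  - rewrite Csum_O. destruct (a 0%nat) as [p q]. rewrite formal_power_at_0 by exact Hf.
    unfold alternate; simpl. ring.
  - rewrite Csum_S, IH. destruct (a (S N)) as [p q]. rewrite formal_power_at_0 by exact Hf.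
    rewrite pow_i by lia. cbn [snd]. ring.
Qed.

Lemma Cmod_fst_le_Bnorm (w : bicomplex) : (Cmod (fst w) <= Bnorm w)%R.
Proof.
  unfold Bnorm. assert (T := Cmod_triangle (fst w + snd w) (fst w - snd w)).
  replace (fst w + snd w + (fst w - snd w)) with (2 * fst w) in T by ring.
  rewrite Cmod_mult, Cmod_R, Rabs_pos_eq in T by lra. lra.
Qed.

Lemma Cmod_snd_le_Bnorm (w : bicomplex) : (Cmod (snd w) <= Bnorm w)%R.
Proof.
  unfold Bnorm. assert (T := Cmod_triangle (fst w + snd w) (- (fst w - snd w))).
  rewrite Cmod_opp in T.
  replace (fst w + snd w + - (fst w - snd w)) with (2 * snd w) in T by ring.
  rewrite Cmod_mult, Cmod_R, Rabs_pos_eq in T by lra. lra.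
Qed.

Lemma Cmod_half_plus_le (p q : C) (e : R) :
  (Cmod p < e)%R -> (Cmod q < e)%R -> (Cmod (/ 2 * (p + q)) < e)%R.
Proof.
  intros Hp Hq. rewrite Cmod_mult, Cmod_inv, Cmod_R, Rabs_pos_eq.
  - generalize (Cmod_triangle p q). lra.
  - lra.
  - intros E. apply (f_equal fst) in E. simpl in E. lra.
Qed.

(** The two expansions are the half-sum and the half-difference of the traces of
    the partial sums on the diagonals. *)
Lemma goursat_of_formal_power_expansion (b : R) (f : R -> C) (u v : R -> R -> C) (a : nat -> bicomplex) :
  formal_power_expansion b f (fun x t => (u x t, v x t)) a ->
  goursat_expansions b f u (fun n => fst (a n)) (fun n => snd (a n)).
Proof.
  intros H.
  assert (Hd : forall eps : posreal, exists N, forall n, (N <= n)%nat -> forall x, segment b x ->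
    (Cmod (fst (partial_sum f a n x x) - u x x) < eps)%R /\
    (Cmod (fst (partial_sum f a n x (- x)) - u x (- x)%R) < eps)%R).
  { intros eps. destruct (H eps) as [N HN]. exists N. intros n Hn x Hx.
    assert (Hx' : segment b (- x)) by (destruct Hx; split; lra).
    split; eapply Rle_lt_trans.
    - apply (Cmod_fst_le_Bnorm (Bminus (partial_sum f a n x x) (u x x, v x x))).
    - apply (HN n Hn (x, x)). split; exact Hx.
    - apply (Cmod_fst_le_Bnorm (Bminus (partial_sum f a n x (- x)) (u x (- x)%R, v x (- x)%R))).
    - apply (HN n Hn (x, (- x)%R)). split; assumption. }
  split; intros eps; destruct (Hd eps) as [N HN]; exists N; intros n Hn x Hx;
    destruct (HN n Hn x Hx) as [H1 H2]; destruct (partial_sum_diagonals f a n x) as [E1 E2].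
  - change (Cmod (even_trace f (fun n => fst (a n)) n x - / 2 * (u x x + u x (- x)%R)) < eps)%R.
    replace (even_trace f (fun n => fst (a n)) n x - / 2 * (u x x + u x (- x)%R)) with
     (/ 2 * ((fst (partial_sum f a n x x) - u x x) + (fst (partial_sum f a n x (- x)) - u x (- x)%R))).
    + apply Cmod_half_plus_le; assumption.
    + rewrite E1, E2. field.
  - change (Cmod (odd_trace f (fun n => snd (a n)) n x - / 2 * (u x x - u x (- x)%R)) < eps)%R.
    replace (odd_trace f (fun n => snd (a n)) n x - / 2 * (u x x - u x (- x)%R)) with
     (/ 2 * ((fst (partial_sum f a n x x) - u x x) + - (fst (partial_sum f a n x (- x)) - u x (- x)%R))).
    + apply Cmod_half_plus_le; [|rewrite Cmod_opp]; assumption.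
    + rewrite E1, E2. field.
Qed.

(** The difference between [W] and a partial sum solves the characteristic system,
    its second component vanishes at the origin by the choice of [d 0], and its
    traces tend to zero uniformly. *)
Lemma formal_power_expansion_of_goursat (b : R) (f f1 f2 : R -> C) (u v : R -> R -> C) (c d : nat -> C) :
  (0 < b)%R -> C2_on_segment b f f1 f2 -> (forall x, segment b x -> f x <> 0) -> f 0%R = 1 ->
  vekua_solution b f f1 (fun x t => (u x t, v x t)) ->
  goursat_expansions b f u c d -> d 0%nat = v 0%R 0%R ->
  formal_power_expansion b f (fun x t => (u x t, v x t)) (fun n => (c n, d n)).
Proof.
  intros Hb [Hf [Hf1 _]] Hnz Hf0 [Wx [Wt [HC Heq]]] [HE HO] Hd0.
  (* Formal powers depend on f only through its values on the segment, so f may be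
     replaced by a continuous nonvanishing function on the line. *)
  set (F := fun x => f (clamp b x)).
  assert (HF : forall x, segment b x -> f x = F x)
    by (intros x Hx; unfold F; rewrite clamp_id; auto).
  assert (HFnz : forall x, F x <> 0) by (intros x; apply Hnz, clamp_segment, Hb).
  assert (Hfc : continuous_on (T := R_UniformSpace) (U := C_R_NormedModule) (segment b) f)
    by (intros x Hx; eapply is_derive_within_continuous, Hf, Hx).
  assert (Hf1c : continuous_on (T := R_UniformSpace) (U := C_R_NormedModule) (segment b) f1)
    by (intros x Hx; eapply is_derive_within_continuous, Hf1, Hx).
  assert (HFc : forall x, Ccontinuous F x)
    by (intros x; apply (clamp_continuous (U := C_R_NormedModule) b x f Hb Hfc)).
  assert (HF0 : F 0%R = 1) by (rewrite <- HF; [exact Hf0|split; lra]).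
  assert (HFd : forall x, (Rabs x < b)%R -> is_Cderive F x (f1 x)).
  { intros x Hx. apply (is_derive_ext_loc (V := C_R_NormedModule) f).
    - generalize (segment_interior _ _ Hx). apply filter_imp, HF.
    - apply (is_derive_within_interior (segment b)); [apply segment_interior, Hx|].
      apply Hf, Rabs_lt_segment, Hx. }
  destruct (Ccontinuous_bounded (fun x => / F x) b) as [L [HL0 HL]].
  { intros x. apply filterlim_Cinv; [apply locally_filter|apply HFnz|apply HFc]. }
  destruct (Ccontinuous_bounded (fun x => f1 (clamp b x)) b) as [M [HM0 HM]].
  { intros x. apply (clamp_continuous (U := C_R_NormedModule) b x f1 Hb Hf1c). }
  destruct (goursat_stability b L M F f1 Hb HL0 HM0) as [kappa [Hkappa Hstab]].
  { intros x Hx. assert (Hsx := Rabs_lt_segment _ _ Hx).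
    split; [auto|split; [auto|split; [auto|]]]. specialize (HM x Hsx). rewrite clamp_id in HM by exact Hsx. exact HM. }
  { exact HF0. }
  assert (HWsol : characteristic_solution b (fun x => f1 x / F x) u v).
  { apply vekua_characteristic_solution; [auto|]. exists Wx, Wt. split; [exact HC|].
    intros x t Hxt. rewrite <- HF by apply Hxt. apply Heq, Hxt. }
  set (a := fun n => (c n, d n)).
  intros eps.
  (* Each trace is controlled by both expansions, hence by twice this error, and
     one more factor 2 makes the final inequality strict. *)
  assert (Hdelta : (0 < eps / (4 * kappa))%R)
    by (apply Rdiv_lt_0_compat; [apply cond_pos|lra]).
  destruct (HE (mkposreal _ Hdelta)) as [N1 HN1]. destruct (HO (mkposreal _ Hdelta)) as [N2 HN2].
  exists (max N1 N2). intros n Hn p Hp.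
  set (U := fun x t => fst (partial_sum F a n x t) + (- (1)) * u x t).
  set (V := fun x t => snd (partial_sum F a n x t) + (- (1)) * v x t).
  assert (Hsol : characteristic_solution b (fun x => f1 x / F x) U V).
  { apply characteristic_solution_combination; [|exact HWsol].
    apply characteristic_solution_partial_sum; assumption. }
  assert (HV0 : V 0%R 0%R = 0).
  { unfold V. rewrite partial_sum_at_origin by exact HF0. unfold a; simpl. rewrite Hd0. ring. }
  assert (Hdiag : forall x, (Rabs x < b)%R ->
     (Cmod (U x x) <= 2 * (eps / (4 * kappa)))%R /\ (Cmod (U x (- x)%R) <= 2 * (eps / (4 * kappa)))%R).
  { intros x Hx. apply Rabs_lt_segment in Hx.
    specialize (HN1 n ltac:(lia) x Hx). specialize (HN2 n ltac:(lia) x Hx).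
    destruct (partial_sum_diagonals f a n x) as [E1 E2].
    unfold U. rewrite <- !(partial_sum_ext b f F a n x) by assumption. rewrite E1, E2.
    change (fun n => fst (a n)) with c. change (fun n => snd (a n)) with d.
    change (Cmod (even_trace f c n x - / 2 * (u x x + u x (- x)%R)) < eps / (4 * kappa))%R in HN1.
    change (Cmod (odd_trace f d n x - / 2 * (u x x - u x (- x)%R)) < eps / (4 * kappa))%R in HN2.
    set (P := even_trace f c n x - / 2 * (u x x + u x (- x)%R)) in HN1.
    set (Q := odd_trace f d n x - / 2 * (u x x - u x (- x)%R)) in HN2.
    split.
    - match goal with |- (Cmod ?z <= _)%R => replace z with (P + Q) by (unfold P, Q; field) end.
      generalize (Cmod_triangle P Q). lra.
    - match goal with |- (Cmod ?z <= _)%R => replace z with (P + - Q) by (unfold P, Q; field) end.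
      generalize (Cmod_triangle P (- Q)). rewrite Cmod_opp. lra. }
  assert (HB := Hstab U V _ Hsol HV0 Hdiag p Hp).
  apply Rle_lt_trans with (kappa * (2 * (eps / (4 * kappa))))%R.
  - eapply Rle_trans; [|exact HB]. right. f_equal.
    change (Bminus (partial_sum f a n (fst p) (snd p)) (u (fst p) (snd p), v (fst p) (snd p))
      = (U (fst p) (snd p), V (fst p) (snd p))).
    rewrite (partial_sum_ext b f F) by (auto; apply Hp).
    unfold Bminus, U, V. cbn [fst snd]. apply f_equal2; ring.
  - replace (kappa * (2 * (eps / (4 * kappa))))%R with (eps / 2)%R by (field; lra).
    generalize (cond_pos eps). lra.
Qed.

(** * Uniqueness of the coefficients *)

(** Convergence at [t = b] makes the radius of convergence positive. *)
Lemma pseries_coefficients_unique (b : R) (p q : nat -> R) :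
  (0 < b)%R ->
  (forall t, segment b t -> exists l, is_pseries p t l /\ is_pseries q t l) ->
  forall n, p n = q n.
Proof.
  intros Hb H n.
  assert (Hr : forall a : nat -> R, (exists l, is_pseries a b l) -> Rbar_lt 0 (CV_radius a)).
  { intros a [l Hl]. apply Rbar_lt_le_trans with (Rabs b).
    - simpl. rewrite Rabs_pos_eq; lra.
    - apply Rbar_not_lt_le. intros Hlt. apply (CV_disk_outside _ _ Hlt).
      apply ex_series_lim_0. exists l. apply is_pseries_R, Hl. }
  assert (Hbb : segment b b) by (split; lra).
  destruct (H b Hbb) as [l [Hp Hq]].
  apply PSeries_ext_recip; [apply Hr; exists l; exact Hp|apply Hr; exists l; exact Hq|].
  assert (H0 : (Rabs 0 < b)%R) by (rewrite Rabs_R0; exact Hb).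
  generalize (segment_interior b 0 H0). apply filter_imp. intros t Ht.
  destruct (H t Ht) as [m [Hpt Hqt]].
  rewrite (is_pseries_unique _ _ _ Hpt), (is_pseries_unique _ _ _ Hqt). reflexivity.
Qed.

Lemma is_pseries_components (alpha : nat -> C) (t : R) (w : C) :
  (forall eps : posreal, exists N, forall n, (N <= n)%nat ->
     (Cmod (Csum (fun k => alpha k * RtoC (t ^ k))%C n - w) < eps)%R) ->
  is_pseries (fun k => fst (alpha k)) t (fst w) /\ is_pseries (fun k => snd (alpha k)) t (snd w).
Proof.
  intros H.
  assert (Hs : forall n,
    fst (Csum (fun k => alpha k * RtoC (t ^ k))%C n) = sum_n (fun k => fst (alpha k) * t ^ k)%R n /\
    snd (Csum (fun k => alpha k * RtoC (t ^ k))%C n) = sum_n (fun k => snd (alpha k) * t ^ k)%R n).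
  { induction n as [|n [IH1 IH2]].
    - rewrite !sum_O. simpl. split; ring.
    - rewrite Csum_S, !sum_Sn, <- IH1, <- IH2. unfold plus; simpl. split; ring. }
  assert (Hl : filterlim (fun n => Csum (fun k => alpha k * RtoC (t ^ k)) n) eventually
     (locally (T := C_R_NormedModule) w)).
  { apply (filterlim_locally_ball_norm (U := C_R_NormedModule)). intros eps.
    destruct (H eps) as [N HN]. exists N. intros n Hn. unfold ball_norm. rewrite norm_C_R.
    apply (HN n Hn). }
  apply filterlim_C_components in Hl; [|apply eventually_filter]. destruct Hl as [H1 H2].
  split; apply is_pseries_R; (eapply filterlim_ext; [|eassumption]); intros n; apply Hs.
Qed.

(** At [x = 0] both components of an expansion are power series in [t] whose
    coefficients are the components of [a n], in an order that depends on the
    parity of [n]. *)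
Lemma formal_power_expansion_unique (b : R) (f : R -> C) (W : R -> R -> bicomplex) (a a' : nat -> bicomplex) :
  (0 < b)%R -> f 0%R = 1 ->
  formal_power_expansion b f W a -> formal_power_expansion b f W a' -> forall n, a n = a' n.
Proof.
  intros Hb Hf Ha Ha'.
  assert (Hseries : forall a, formal_power_expansion b f W a -> forall t, segment b t ->
     (is_pseries (fun k => fst (alternate (fst (a k)) (snd (a k)) k)) t (fst (fst (W 0%R t))) /\
      is_pseries (fun k => snd (alternate (fst (a k)) (snd (a k)) k)) t (snd (fst (W 0%R t)))) /\
     (is_pseries (fun k => fst (alternate (snd (a k)) (fst (a k)) k)) t (fst (snd (W 0%R t))) /\
      is_pseries (fun k => snd (alternate (snd (a k)) (fst (a k)) k)) t (snd (snd (W 0%R t))))).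
  { clear a a' Ha Ha'. intros a Ha t Ht.
    assert (Hp : square b (0%R, t)) by (split; [split; simpl; lra|exact Ht]).
    assert (Hz : forall n, formal_power f n (a n) 0 t =
       (alternate (fst (a n)) (snd (a n)) n * RtoC (t ^ n),
        alternate (snd (a n)) (fst (a n)) n * RtoC (t ^ n))).
    { intros n. destruct (a n) as [p q]. apply formal_power_at_0, Hf. }
    assert (E1 : forall N, fst (partial_sum f a N 0 t) =
       Csum (fun n => alternate (fst (a n)) (snd (a n)) n * RtoC (t ^ n)) N).
    { intros N. rewrite partial_sum_components. cbn [fst].
      apply (sum_n_ext (G := C_AbelianMonoid)). intros n. rewrite Hz. reflexivity. }
    assert (E2 : forall N, snd (partial_sum f a N 0 t) =
       Csum (fun n => alternate (snd (a n)) (fst (a n)) n * RtoC (t ^ n)) N).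
    { intros N. rewrite partial_sum_components. cbn [snd].
      apply (sum_n_ext (G := C_AbelianMonoid)). intros n. rewrite Hz. reflexivity. }
    split; apply (is_pseries_components (fun k => alternate _ _ k)); intros eps;
      destruct (Ha eps) as [N HN]; exists N; intros n Hn;
      (eapply Rle_lt_trans; [|apply (HN n Hn (0%R, t) Hp)]).
    - rewrite <- E1. apply (Cmod_fst_le_Bnorm (Bminus (partial_sum f a n 0 t) (W 0%R t))).
    - rewrite <- E2. apply (Cmod_snd_le_Bnorm (Bminus (partial_sum f a n 0 t) (W 0%R t))). }
  assert (HA := Hseries a Ha). assert (HA' := Hseries a' Ha'). intros n.
  assert (E11 := pseries_coefficients_unique b _ _ Hb (fun t Ht =>
     ex_intro _ _ (conj (proj1 (proj1 (HA t Ht))) (proj1 (proj1 (HA' t Ht))))) n).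
  assert (E12 := pseries_coefficients_unique b _ _ Hb (fun t Ht =>
     ex_intro _ _ (conj (proj2 (proj1 (HA t Ht))) (proj2 (proj1 (HA' t Ht))))) n).
  assert (E21 := pseries_coefficients_unique b _ _ Hb (fun t Ht =>
     ex_intro _ _ (conj (proj1 (proj2 (HA t Ht))) (proj1 (proj2 (HA' t Ht))))) n).
  assert (E22 := pseries_coefficients_unique b _ _ Hb (fun t Ht =>
     ex_intro _ _ (conj (proj2 (proj2 (HA t Ht))) (proj2 (proj2 (HA' t Ht))))) n).
  cbv beta in E11, E12, E21, E22.
  unfold alternate in *. destruct (Nat.even n);
  apply injective_projections; apply injective_projections; assumption.
Qed.

Theorem theorem6p1 (b : R) (f f1 f2 : R -> C) (u v : R -> R -> C)
  (hb : (0 < b)%R)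
  (hf : C2_on_segment b f f1 f2)
  (hf_nz : forall x : R, segment b x -> f x <> RtoC 0)
  (hf0 : f 0%R = RtoC 1)
  (hW : vekua_solution b f f1 (fun x t : R => (u x t, v x t))) :
  ((exists a : nat -> bicomplex,
      formal_power_expansion b f (fun x t : R => (u x t, v x t)) a)
   <->
   (exists c bb : nat -> C, goursat_expansions b f u c bb))
  /\
  (forall (a : nat -> bicomplex) (c bb : nat -> C),
     formal_power_expansion b f (fun x t : R => (u x t, v x t)) a ->
     goursat_expansions b f u c bb ->
     bb 0%nat = v 0%R 0%R ->
     forall n : nat, a n = (c n, bb n)).
Proof.
  split; [split|].
  - intros [a Ha]. exists (fun n => fst (a n)), (fun n => snd (a n)).
    apply (goursat_of_formal_power_expansion b f u v a Ha).
  - intros [c [bb [HE HO]]].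
    (* The expansions leave bb 0 free; it has to be the value of v at the origin. *)
    set (d := fun n => match n with O => v 0%R 0%R | S _ => bb n end).
    exists (fun n => (c n, d n)).
    apply (formal_power_expansion_of_goursat b f f1 f2); auto.
    split; [exact HE|]. intros eps. destruct (HO eps) as [N HN]. exists N. intros n Hn x Hx.
    rewrite (sum_n_m_ext_loc (G := C_AbelianMonoid) _ (fun n => bb n * wave_u f (2 * n) x x)).
    + apply HN; assumption.
    + intros [|k] Hk; [lia|reflexivity].
  - intros a c bb Ha Hg H0. apply (formal_power_expansion_unique b f _ _ (fun n => (c n, bb n)) hb hf0 Ha).
    apply (formal_power_expansion_of_goursat b f f1 f2); assumption.
Qed.
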